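(* The rightward winning-position functor $\mathcal W_r:\mathbf{roMPG}\to\mathbb S_r$ is a traced symmetric monoidal functor; in particular $\mathcal W_r(\mathcal A;\mathcal B)=\mathcal W_r(\mathcal A);\mathcal W_r(\mathcal B)$, $\mathcal W_r(\mathcal A\oplus\mathcal B)=\mathcal W_r(\mathcal A)\oplus\mathcal W_r(\mathcal B)$ and $\mathcal W_r(\mathrm{tr}^l_{m,n}(\mathcal E))=\mathrm{tr}^l_{m,n}(\mathcal W_r(\mathcal E))$ for all roMPGs $\mathcal A,\mathcal B,\mathcal E$ of appropriate types.
   Context: Notation: $[k]=\{1,\dots,k\}$ ($[0]=\emptyset$); $X+Y$ disjoint union; composition is diagrammatic $;$. roMPGs. An roMPG $\mathcal A:m\to n$ is a tuple $(m,n,Q,E,\rho,w)$: $Q$ a finite set of positions, entrances $[m]$, exits $[n]$ (pairwise disjoint with $Q$), edges $E\subseteq([m]+Q)\times([n]+Q)$ with every entrance having exactly one successor and every exit at most one predecessor, roles $\rho:Q\to\{\exists,\forall\}$, weights $w:Q\to\mathbb R$. For $\mathcal A:m\to l$, $\mathcal B:l\to n$, $\mathcal A;\mathcal B:m\to n$ has positions $Q^{\mathcal A}+Q^{\mathcal B}$ with inherited roles/weights and edges: edges of $\mathcal A$ from $[m]+Q^{\mathcal A}$ to $Q^{\mathcal A}$; edges of $\mathcal B$ from $Q^{\mathcal B}$ to $[n]+Q^{\mathcal B}$; $(s,s')$ with $s\in[m]+Q^{\mathcal A}$, $s'\in[n]+Q^{\mathcal B}$ whenever some $i\in[l]$ has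 $(s,i)\in E^{\mathcal A}$ and $(i,s')\in E^{\mathcal B}$; nothing else. $\mathcal A\oplus\mathcal B:m+k\to n+l$ (for $\mathcal A:m\to n$, $\mathcal B:k\to l$) is the disjoint union with $\mathcal B$'s entrances/exits renamed $j\mapsto m+j$, $j\mapsto n+j$. For $\mathcal A:l+m\to l+n$, $\mathrm{tr}^l_{m,n}(\mathcal A):m\to n$ has the same positions, roles, weights, and $(s,s')\in([m]+Q)\times([n]+Q)$ is an edge iff there are $k\ge0$, $i_1,\dots,i_k\in[l]$ with $(\hat s,i_1),(i_1,i_2),\dots,(i_k,\hat s')\in E^{\mathcal A}$ (for $k=0$: $(\hat s,\hat s')\in E^{\mathcal A}$), where $i_j$ is an exit as target and an entrance as source, and $\hat s=l+s$ for entrances/exits, $\hat s=s$ for positions. $\mathrm{id}_m$ has no positions and edges $(i,i)$; $\sigma_{m,n}:m+n\to n+m$ has no positions and edges $(i,n+i)$, $(m+j,j)$. $\mathbf{roMPG}$: objects $\mathbb N$, arrows roMPGs up to isomorphism (bijection of positions preserving edges, roles, weights, identity on open ends), with $;$, $\oplus$, $\mathrm{tr}$, $\mathrm{id}$, $\sigma$. Plays. In $\mathcal A:m\to n$, a play from entrance $i$ is a sequence $(s_j)_{j\in J}$, $J=\{0,..,M\}$ or $\mathbb N$, with $s_0=i$, consecutive elements joined by edges, and $s_M$ without successor if $J$ is finite. An infinite play satisfies the MP condition if $\liminf_N\frac1N\sum_{j=1}^Nw(s_j)\ge0$. $T(X)=X+\mathbb R\times X+\{\exists^*,\forall^*\}$.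 The denotation $[\![\pi]\!]\in T([n])$: $s_1$ if $J=\{0,1\}$ and $s_1$ is an exit; $(\sum_{j=1}^{M-1}w(s_j),s_M)$ if $M\ge2$ and $s_M$ is an exit; $\exists^*$ if $J$ finite with $s_M$ a $\forall$-position, or $J$ infinite satisfying MP; $\forall^*$ if $J$ finite with $s_M$ an $\exists$-position, or $J$ infinite failing MP. An $\exists$-strategy is a partial function $\tau:\rho^{-1}(\exists)\rightharpoonup[n]+Q$ defined exactly on positions with a successor, with $(s,\tau(s))\in E$; similarly $\forall$-strategies; sets $\Sigma_\exists(\mathcal A),\Sigma_\forall(\mathcal A)$. The induced play $\pi^{\tau_\exists,\tau_\forall}_i$ is the unique play from $i$ following $\tau_\exists$, $\tau_\forall$. Semantic categories. $\mathbb S^{\mathbb P}_r$: objects $\mathbb N$; arrows $f:m\to n$ are functions $[m]\to T([n])$ such that if $f(i)=k\in[n]$ then $f(j)\ne k$ and $f(j)\ne(r,k)$ for all $j\ne i$, $r\in\mathbb R$. $(f;g)(i)=f(i)$ if $f(i)\in\{\exists^*,\forall^*\}$; $g(j)$ if $f(i)=j$; $g(j)$ if $f(i)=(r,j)$, $g(j)\in\{\exists^*,\forall^*\}$; $(r,k)$ if $f(i)=(r,j)$, $g(j)=k$; $(r+r',k)$ if $f(i)=(r,j)$, $g(j)=(r',k)$. $\mathrm{id}(i)=i$; $\sigma_{m,n}(i)=n+i$ ($i\le m$), $\sigma_{m,n}(m+j)=j$; $(f\oplus g)(i)=f(i)$ for $i\le m$ and $(f\oplus g)(m+i)$ is $g(i)$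 with its index $j$ (if any) shifted to $n+j$. Trace of $f:l+m\to l+n$ at $i\in[m]$: $v_0=l+i$; if $j=0$ or $v_j\in[l]$ then $v_{j+1}=f(v_j)$; if $v_j=(r,k)$, $k\in[l]$, then $v_{j+1}=f(k)$; otherwise the sequence stops at $v_j$. If finite $(v_0,..,v_K)$, with $S$ the sum of first components of all $v_j\in\mathbb R\times[l+n]$, $1\le j\le K$: result $v_K$ if $v_K\in\{\exists^*,\forall^*\}$; $k$ if $v_K=l+k$ and no earlier $v_j$ carries a weight; $(S,k)$ if $v_K=l+k$ and some earlier $v_j$ carries a weight; $(S,k)$ if $v_K=(r,l+k)$. If infinite, with $w'_1,w'_2,\dots$ the first components of the (infinitely many) entries in $\mathbb R\times[l]$: $\exists^*$ if $\liminf_N\frac1N\sum_{t\le N}w'_t\ge0$, else $\forall^*$. $\mathbb S_r$: objects $\mathbb N$; arrows $m\to n$ are finite sets of finite sets of arrows $m\to n$ of $\mathbb S^{\mathbb P}_r$; $F;G=\{\{f;g\mid f\in F',g\in G'\}\mid F'\in F,G'\in G\}$, $\oplus$ analogously, $\mathrm{tr}(F)=\{\{\mathrm{tr}(f)\mid f\in F'\}\mid F'\in F\}$, identities $\{\{\mathrm{id}\}\}$, symmetries $\{\{\sigma\}\}$. $\mathcal W_r$ is the identity on objects and $\mathcal W_r(\mathcal A)=\big\{\{(i\mapsto[\![\pi^{\tau_\exists,\tau_\forall}_i]\!])\mid\tau_\forall\in\Sigma_\forall(\mathcal A)\}\mid\tau_\exists\in\Sigma_\exists(\mathcal A)\big\}$.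 *)

(* Defs.v *)
From HB Require Import structures.
From mathcomp Require Import all_boot all_order all_algebra.
From mathcomp Require Import mathcomp_extra boolp classical_sets functions cardinality.
From mathcomp Require Import reals constructive_ereal ereal topology sequences.

Set Implicit Arguments.
Unset Strict Implicit.
Unset Printing Implicit Defensive.

Import Order.TTheory GRing.Theory Num.Theory.
Local Open Scope ring_scope.
Local Open Scope classical_set_scope.

Inductive role := Ex | Fa.

Section Defs.
Variable R : realType.

(* roMPGs  m -> n : entrances 'I_m, exits 'I_n, positions a finType Q   *)
Record roMPG (m n : nat) := MkRoMPG {
  pos : finType;
  edge : 'I_m + pos -> 'I_n + pos -> Prop;
  rho : pos -> role;
  wt : pos -> R }.
Arguments pos {m n} r.
Arguments edge {m n} r _ _.
Arguments rho {m n} r _.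
Arguments wt {m n} r _.

Definition wf m n (A : roMPG m n) : Prop :=
  (forall i : 'I_m, exists! t, edge A (inl i) t) /\
  (forall (k : 'I_n) s1 s2, edge A s1 (inl k) -> edge A s2 (inl k) -> s1 = s2).

Definition liftQ (X Q1 Q2 : Type) (h : Q1 -> Q2) (s : X + Q1) : X + Q2 :=
  match s with inl x => inl x | inr q => inr (h q) end.

Definition iso m n (A B : roMPG m n) : Prop :=
  exists h : pos A -> pos B, bijective h /\
    (forall s s', edge A s s' <-> edge B (liftQ h s) (liftQ h s')) /\
    (forall q, rho B (h q) = rho A q) /\ (forall q, wt B (h q) = wt A q).

Section Comp.
Variables (m l n : nat) (A : roMPG m l) (B : roMPG l n).
Definition cQ : finType := (pos A + pos B)%type.
Definition srcA (s : 'I_m + cQ) : option ('I_m + pos A) :=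
  match s with inl i => Some (inl i) | inr (inl q) => Some (inr q) | _ => None end.
Definition srcB (s : 'I_m + cQ) : option (pos B) :=
  match s with inr (inr q) => Some q | _ => None end.
Definition tgtA (s : 'I_n + cQ) : option (pos A) :=
  match s with inr (inl q) => Some q | _ => None end.
Definition tgtB (s : 'I_n + cQ) : option ('I_n + pos B) :=
  match s with inl k => Some (inl k) | inr (inr q) => Some (inr q) | _ => None end.
Definition comp_edge (s : 'I_m + cQ) (s' : 'I_n + cQ) : Prop :=
  (exists a qa, srcA s = Some a /\ tgtA s' = Some qa /\ edge A a (inr qa)) \/
  (exists qb b, srcB s = Some qb /\ tgtB s' = Some b /\ edge B (inr qb) b) \/
  (exists a b (j : 'I_l), srcA s = Some a /\ tgtB s' = Some b /\
     edge A a (inl j) /\ edge B (inl j) b).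
Definition comp_rho (q : cQ) : role :=
  match q with inl q => rho A q | inr q => rho B q end.
Definition comp_wt (q : cQ) : R :=
  match q with inl q => wt A q | inr q => wt B q end.
Definition compG : roMPG m n := MkRoMPG comp_edge comp_rho comp_wt.
End Comp.

Section Sum.
Variables (m n k l : nat) (A : roMPG m n) (B : roMPG k l).
Definition sQ : finType := (pos A + pos B)%type.
Definition sum_src (s : 'I_(m + k) + sQ) : ('I_m + pos A) + ('I_k + pos B) :=
  match s with
  | inl i => match fintype.split i with inl a => inl (inl a) | inr b => inr (inl b) end
  | inr (inl q) => inl (inr q)
  | inr (inr q) => inr (inr q)
  end.
Definition sum_tgt (s : 'I_(n + l) + sQ) : ('I_n + pos A) + ('I_l + pos B) :=
  match s with
  | inl i => match fintype.split i with inl a => inl (inl a) | inr b => inr (inl b) end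
  | inr (inl q) => inl (inr q)
  | inr (inr q) => inr (inr q)
  end.
Definition sum_edge (s : 'I_(m + k) + sQ) (s' : 'I_(n + l) + sQ) : Prop :=
  match sum_src s, sum_tgt s' with
  | inl a, inl a' => edge A a a'
  | inr b, inr b' => edge B b b'
  | _, _ => False
  end.
Definition sum_rho (q : sQ) : role :=
  match q with inl q => rho A q | inr q => rho B q end.
Definition sum_wt (q : sQ) : R :=
  match q with inl q => wt A q | inr q => wt B q end.
Definition sumG : roMPG (m + k) (n + l) := MkRoMPG sum_edge sum_rho sum_wt.
End Sum.

Section Trace.
Variables (l m n : nat) (A : roMPG (l + m) (l + n)).
Fixpoint chain (a : 'I_(l + m) + pos A) (p : seq 'I_l) (b : 'I_(l + n) + pos A)
  : Prop :=
  match p with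
  | [::] => edge A a b
  | j :: p' => edge A a (inl (lshift n j)) /\ chain (inl (lshift m j)) p' b
  end.
Definition hat_src (s : 'I_m + pos A) : 'I_(l + m) + pos A :=
  match s with inl i => inl (rshift l i) | inr q => inr q end.
Definition hat_tgt (s : 'I_n + pos A) : 'I_(l + n) + pos A :=
  match s with inl i => inl (rshift l i) | inr q => inr q end.
Definition tr_edge (s : 'I_m + pos A) (s' : 'I_n + pos A) : Prop :=
  exists p : seq 'I_l, chain (hat_src s) p (hat_tgt s').
Definition trG : roMPG m n := MkRoMPG tr_edge (rho A) (wt A).
End Trace.

Definition void_role (v : void) : role := match v with end.
Definition void_wt (v : void) : R := match v with end.

Definition id_edge m (s : 'I_m + void) (s' : 'I_m + void) : Prop :=
  match s, s' with inl i, inl j => i = j | _, _ => False end.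
Definition idG m : roMPG m m := MkRoMPG (id_edge (m:=m)) void_role void_wt.

Definition sym_edge m n (s : 'I_(m + n) + void) (s' : 'I_(n + m) + void) : Prop :=
  match s, s' with
  | inl a, inl b =>
      match fintype.split a with inl i => b = rshift n i | inr j => b = lshift m j end
  | _, _ => False
  end.
Definition symG m n : roMPG (m + n) (n + m) :=
  MkRoMPG (sym_edge (m:=m) (n:=n)) void_role void_wt.

Inductive outc (n : nat) :=
  | Exit of 'I_n | WExit of R & 'I_n | EWin | AWin.
Arguments EWin {n}.
Arguments AWin {n}.

(* mean-payoff condition: liminf_N (1/N) sum_{t=1}^N a_t >= 0
   (a is indexed from 0, i.e. a t = a_{t+1}) *)
Definition mp_ok (a : nat -> R) : Prop :=
  (0 <= limn_einf (fun N : nat => ((N.+1%:R)^-1 * \sum_(t < N.+1) a t)%:E))%E.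

Section Plays.
Variables (m n : nat) (A : roMPG m n).
Definition vtx := ('I_n + pos A)%type.

Definition strategy (r : role) (tau : pos A -> option vtx) : Prop :=
  forall q, (rho A q = r ->
               ((exists t, edge A (inr q) t) <-> tau q <> None) /\
               (forall t, tau q = Some t -> edge A (inr q) t)) /\
            (rho A q <> r -> tau q = None).
Definition SigmaE := [set tau | strategy Ex tau].
Definition SigmaF := [set tau | strategy Fa tau].

(* a play (s_j)_j from entrance i is encoded by s : nat -> option vtx with
   s k = Some s_{k+1}, and s k = None iff the play has ended before index k+1 *)
Definition induced (tauE tauF : pos A -> option vtx) (i : 'I_m)
    (s : nat -> option vtx) : Prop :=
  (match s 0%N with
   | Some t => edge A (inl i) t
   | None => forall t, ~ edge A (inl i) t
   end) /\
  forall k, s k.+1 =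
    match s k with
    | Some (inr q) => match rho A q with Ex => tauE q | Fa => tauF q end
    | _ => None
    end.

Definition wt_of (o : option vtx) : R :=
  match o with Some (inr q) => wt A q | _ => 0 end.

Definition denotes (s : nat -> option vtx) (o : outc n) : Prop :=
  (exists K (x : vtx), s K = Some x /\ s K.+1 = None /\
     match x with
     | inl k => if K == 0%N then o = Exit k
                else o = WExit (\sum_(j < K) wt_of (s j)) k
     | inr q => match rho A q with Fa => o = EWin | Ex => o = AWin end
     end) \/
  ((forall k, s k <> None) /\
   ((mp_ok (fun j => wt_of (s j)) /\ o = EWin) \/
    (~ mp_ok (fun j => wt_of (s j)) /\ o = AWin))).

Definition W : set (set ('I_m -> outc n)) :=
  [set H | exists tauE, SigmaE tauE /\
     H = [set f | exists tauF, SigmaF tauF /\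
            forall i, exists s, induced tauE tauF i s /\ denotes s (f i)]].
End Plays.

Definition SParrow m n := 'I_m -> outc n.

Definition validSP m n (f : SParrow m n) : Prop :=
  forall (i j : 'I_m) (k : 'I_n) (r : R), i <> j -> f i = Exit k ->
    f j <> Exit k /\ f j <> WExit r k.

Definition compSP m l n (f : SParrow m l) (g : SParrow l n) : SParrow m n :=
  fun i =>
  match f i with
  | EWin => EWin
  | AWin => AWin
  | Exit j => g j
  | WExit r j =>
      match g j with
      | EWin => EWin
      | AWin => AWin
      | Exit k => WExit r k
      | WExit r' k => WExit (r + r') k
      end
  end.

Definition idSP m : SParrow m m := fun i => Exit i.

Definition symSP m n : SParrow (m + n) (n + m) :=
  fun i => match fintype.split i with
           | inl a => Exit (rshift n a)
           | inr b => Exit (lshift m b)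
           end.

Definition omap_out n n' (h : 'I_n -> 'I_n') (o : outc n) : outc n' :=
  match o with
  | Exit k => Exit (h k)
  | WExit r k => WExit r (h k)
  | EWin => EWin
  | AWin => AWin
  end.

Definition sumSP m n k l (f : SParrow m n) (g : SParrow k l) : SParrow (m + k) (n + l) :=
  fun i => match fintype.split i with
           | inl a => omap_out (@lshift n l) (f a)
           | inr b => omap_out (@rshift n l) (g b)
           end.

(* trace of f : l+m -> l+n at i : the sequence v_1, v_2, ... (v_0 = l+i),
   encoded as tr_seq f i j = Some v_{j+1}, None once the sequence stopped *)
Section TraceSP.
Variables (l m n : nat) (f : SParrow (l + m) (l + n)).
Fixpoint tr_seq (i : 'I_m) (j : nat) : option (outc (l + n)) :=
  match j with
  | 0 => Some (f (rshift l i))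
  | j'.+1 =>
      match tr_seq i j' with
      | Some (Exit k) | Some (WExit _ k) =>
          match fintype.split k with inl a => Some (f (lshift m a)) | inr _ => None end
      | _ => None
      end
  end.

Definition weighted (o : option (outc (l + n))) : bool :=
  match o with Some (WExit _ _) => true | _ => false end.
Definition wfst (o : option (outc (l + n))) : R :=
  match o with Some (WExit r _) => r | _ => 0 end.

Definition trSP_at (i : 'I_m) (o : outc n) : Prop :=
  (exists K (x : outc (l + n)), tr_seq i K = Some x /\ tr_seq i K.+1 = None /\
     let S := \sum_(j < K.+1) wfst (tr_seq i j) in
     match x with
     | EWin => o = EWin
     | AWin => o = AWin
     | Exit k' =>
         match fintype.split k' with
         | inl _ => False
         | inr k => if [exists j : 'I_K, weighted (tr_seq i j)]
                    then o = WExit S k else o = Exit k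
         end
     | WExit _ k' =>
         match fintype.split k' with inl _ => False | inr k => o = WExit S k end
     end) \/
  ((forall j, tr_seq i j <> None) /\
   exists phi : nat -> nat, {homo phi : a b / (a < b)%N} /\
     (forall j, weighted (tr_seq i j) <-> exists t, phi t = j) /\
     let w' := fun t => wfst (tr_seq i (phi t)) in
     ((mp_ok w' /\ o = EWin) \/ (~ mp_ok w' /\ o = AWin))).

Definition trSP (g : SParrow m n) : Prop := forall i, trSP_at i (g i).
End TraceSP.

Definition Sarrow m n := set (set (SParrow m n)).

Definition isSr m n (F : Sarrow m n) : Prop :=
  finite_set F /\
  forall F', F F' -> finite_set F' /\ forall f, F' f -> validSP f.

Definition compS m l n (F : Sarrow m l) (G : Sarrow l n) : Sarrow m n :=
  [set H | exists F' G', F F' /\ G G' /\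
     H = [set h | exists f g, F' f /\ G' g /\ h = compSP f g]].

Definition sumS m n k l (F : Sarrow m n) (G : Sarrow k l) : Sarrow (m + k) (n + l) :=
  [set H | exists F' G', F F' /\ G G' /\
     H = [set h | exists f g, F' f /\ G' g /\ h = sumSP f g]].

Definition trS l m n (F : Sarrow (l + m) (l + n)) : Sarrow m n :=
  [set H | exists F', F F' /\ H = [set g | exists f, F' f /\ trSP f g]].

Definition idS m : Sarrow m m := [set [set @idSP m]].
Definition symS m n : Sarrow (m + n) (n + m) := [set [set @symSP m n]].

End Defs.

(* Main.v *)
(** A play is the run of a deterministic system on exits and positions, and its outcome [outf] is
    computed by adding the weight of the first position to the outcome of the rest of the run.
    If a relation between the targets of two games is preserved by their moves and keeps positions
    (with role and weight), then the outcome in the second game is the outcome in the first one,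
    continued from the exit that it reached. Isomorphism, composition and monoidal product are
    instances of this, strategies being matched position by position. For the trace, the relation
    follows the feedback loops from a target; this ends because exits have at most one predecessor.
    An infinite trace sequence groups the positions of an infinite play into consecutive blocks of
    bounded length, and the sign of the lower mean payoff is the same for the sequence of block
    sums as for the sequence of weights. *)

Require Import Defs.
From HB Require Import structures.
From mathcomp Require Import all_boot all_order all_algebra.
From mathcomp Require Import mathcomp_extra boolp classical_sets functions cardinality.
From mathcomp Require Import reals constructive_ereal ereal topology sequences.
From mathcomp Require Import zify ring lra.

Set Implicit Arguments.
Unset Strict Implicit.
Unset Printing Implicit Defensive.

Import Order.TTheory GRing.Theory Num.Theory.
Local Open Scope ring_scope.
Local Open Scope classical_set_scope.

(** * The mean-payoff condition *)

Section MeanPayoff.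
Variable R : realType.
Implicit Types a b : nat -> R.

(** The limit of the nondecreasing sequence of infima is its supremum, which is nonnegative iff it
    exceeds every negative number. Multiplying by [N] keeps extended reals and division out of the
    later arguments. *)
Lemma mp_okP a : mp_ok a <-> forall e, 0 < e -> exists N0, forall N, (N0 <= N)%N ->
  - (e * N%:R) <= \sum_(t < N) a t.
Proof.
rewrite /mp_ok limn_einf_lim.
set u := fun N : nat => _.
have -> : limn (einfs u) = ereal_sup (range (einfs u)).
  by apply: cvg_lim => //; exact: cvg_einfs_sup.
have avgP e (N : nat) : ((- e)%:E <= u N)%E = (- (e * N.+1%:R) <= \sum_(t < N.+1) a t).
  by rewrite /u lee_fin mulrC ler_pdivlMr ?ltr0n// mulNr.
split=> [supge0 e e0|avg].
- have /ereal_sup_gt[_ [N0 _ <-] gtN0] : ((- e)%:E < ereal_sup (range (einfs u)))%E.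
    by apply: lt_le_trans supge0; rewrite lte_fin oppr_lt0.
  (* [u N] averages [N.+1] terms, hence the shifted threshold. *)
  exists N0.+1 => -[//|N] N0N; rewrite -avgP; apply/ltW/(lt_le_trans gtN0).
  by apply: ereal_inf_lbound; exists N.
- apply/lee_subgt0Pr => e e0; have [N0 HN0] := avg _ e0.
  apply: le_ereal_sup_tmp; exists (einfs u N0); first by exists N0.
  rewrite sub0e -EFinN; apply: le_ereal_inf_tmp => _ [N /= N0N <-].
  by rewrite avgP; apply: HN0; exact: leqW.
Qed.

(** The lengths [M] and [N] bound each other linearly, so an error of small slope in [M] has small
    slope in [N], and the constant [D] is absorbed for large [N]. *)
Lemma mp_dom a b (C : nat) (D : R) : (0 < C)%N ->
  (forall N, exists M, [/\ (M <= C * N + C)%N, (N <= C * M + C)%N &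
     \sum_(t < M) b t - D <= \sum_(t < N) a t]) ->
  mp_ok b -> mp_ok a.
Proof.
move=> C0 dom /mp_okP mpb; apply/mp_okP => e e0.
have C0' : 0 < C%:R :> R by rewrite ltr0n.
(* As [M <= C * N + C], this slope costs at most [e / 2 * N + e / 2]. *)
have [|N0 HN0] := mpb (e / (2 * C%:R)).
  by rewrite divr_gt0// mulr_gt0.
(* From [N1] on, the other half of [e * N] pays for [e / 2 + D]. *)
have [N1 HN1] : exists N1 : nat, e + D * 2 <= e * N1%:R.
  have [N1 HN1] : exists N1 : nat, (e + D * 2) / e < N1%:R.
    by exists (Num.truncn `|(e + D * 2) / e|).+1; apply: le_lt_trans (ler_norm _) (truncnS_gt _).
  by exists N1; rewrite ltW// [e * _]mulrC -ltr_pdivrMr.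
(* With [N <= C * M + C], the part [C * N0 + C] forces [N0 <= M]. *)
exists (C * N0 + C + N1)%N => N NN.
have [M [MN NM le]] := dom N.
have N0M : (N0 <= M)%N.
  have : (C * N0 <= C * M)%N by lia.
  by rewrite leq_pmul2l.
apply: le_trans le; apply: le_trans (lerB (HN0 M N0M) (lexx D)).
have leM : e / (2 * C%:R) * M%:R <= e / 2 * N%:R + e / 2.
  have -> : e / 2 * N%:R + e / 2 = e / (2 * C%:R) * (C * N + C)%:R.
    by rewrite natrD natrM; field; rewrite gt_eqF.
  by rewrite ler_wpM2l ?ler_nat// divr_ge0 ?ltW// mulr_gt0.
have : e * N1%:R <= e * N%:R by rewrite ler_wpM2l ?ler_nat ?(ltW e0)//; lia.
lra.
Qed.

Lemma mp_shift a : mp_ok (fun t => a t.+1) <-> mp_ok a.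
Proof.
split; apply: (@mp_dom _ _ 1 `|a 0|) => // N.
- exists N.-1; split; [lia|lia|].
  case: N => [|N] /=; first by rewrite !big_ord0 sub0r oppr_le0.
  by rewrite [leRHS]big_ord_recl addrC lerD// lerNl -normrN ler_norm.
- exists N.+1; split; [lia|lia|].
  by rewrite big_ord_recl /= lerBlDr addrC lerD2l ler_norm.
Qed.

(** [b] lists the sums of consecutive blocks of [a], and the first [k] blocks end at [P k]. A prefix
    of [b] has the sum of a prefix of [a]; conversely, cutting a prefix of [a] back to the last
    block end changes its sum by at most [C%:R * B]. *)
Lemma mp_blocks a b (P : nat -> nat) (C : nat) (B : R) :
  (forall t, `|a t| <= B) -> P 0%N = 0%N ->
  (forall k, (P k < P k.+1 <= P k + C)%N) ->
  (forall k, \sum_(i < k) b i = \sum_(t < P k) a t) ->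
  mp_ok b <-> mp_ok a.
Proof.
move=> aB P0 Pgap sumP.
have C0 : (0 < C)%N by have := Pgap 0%N; lia.
have leP k : (k <= P k)%N.
  by elim: k => // k IH; have /andP[lt _] := Pgap k; exact: leq_ltn_trans IH lt.
have Ple k : (P k <= C * k)%N.
  elim: k => [|k IH]; first by rewrite P0.
  by have := Pgap k; rewrite mulnS; lia.
split.
- apply: (@mp_dom _ _ C (C%:R * B)) => // N.
  (* [k] is the number of blocks that are complete at length [N]. *)
  have [k /andP[PkN NPk]] : exists k, (P k <= N < P k.+1)%N.
    elim: N => [|N [k /andP[PkN NPk]]]; first by exists 0%N; have := Pgap 0%N; lia.
    have [lt|ge] := ltnP N.+1 (P k.+1); first by exists k; lia.
    by exists k.+1; have := Pgap k.+1; lia.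
  exists k; split.
  + by have := leP k; nia.
  + by have := Ple k.+1; rewrite mulnS; lia.
  + have [d Nd dC] : exists2 d, N = (P k + d)%N & (d <= C)%N.
      by exists (N - P k)%N; have := Pgap k; lia.
    rewrite sumP Nd big_split_ord /= lerD2l.
    have B0 : 0 <= B by exact: le_trans (normr_ge0 _) (aB 0%N).
    apply: le_trans (_ : - (d%:R * B) <= _).
      by rewrite lerN2 ler_wpM2r// ler_nat.
    rewrite -[d in d%:R]card_ord mulr_natl -sumr_const -sumrN ler_sum// => i _.
    by rewrite lerNl; apply: le_trans (aB (P k + i)%N); rewrite -normrN ler_norm.
- apply: (@mp_dom _ _ C 0) => // k; exists (P k); split.
  + by have := Ple k; lia.
  + by have := leP k; nia.
  + by rewrite subr0 sumP.
Qed.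

End MeanPayoff.

(** * Outcomes of deterministic runs *)

Section Outcome.
Variables (R : realType) (m n : nat) (A : roMPG R m n).
Variable nx : pos A -> option (vtx A).
Implicit Types t : vtx A.

(** As in [induced], the entrance is left out: index [0] is the target of its edge. *)
Fixpoint run t (k : nat) : option (vtx A) :=
  if k is k'.+1 then if run t k' is Some (inr q) then nx q else None else Some t.

Lemma run_exit (i : 'I_n) k : run (inl i) k.+1 = None.
Proof. by elim: k => //= k ->. Qed.

Lemma runD t t' p k : run t p = Some t' -> run t (p + k) = run t' k.
Proof. by move=> tp; elim: k => [|k IH]; rewrite ?addn0// addnS /= IH. Qed.

Lemma run_step q t k : nx q = Some t -> run (inr q) k.+1 = run t k.
Proof. by move=> qt; rewrite -add1n; apply: runD. Qed.

Lemma run_mono t j k : (j <= k)%N -> run t j = None -> run t k = None.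
Proof. by move=> /subnK <-; elim: (k - j)%N => //= d IH /IH ->. Qed.

Lemma denotes_unique t o1 o2 : denotes (run t) o1 -> denotes (run t) o2 -> o1 = o2.
Proof.
move=> [[K1 [x1 [s1 [e1 h1]]]]|[i1 h1]] [[K2 [x2 [s2 [e2 h2]]]]|[i2 h2]].
- have eK : K1 = K2.
    apply/eqP; rewrite eqn_leq; apply/andP; split; rewrite leqNgt; apply/negP => lt.
    + by rewrite (run_mono lt e2) in s1.
    + by rewrite (run_mono lt e1) in s2.
  rewrite -eK s1 in s2 h2; case: s2 => ex; rewrite -ex in h2.
  case: x1 {s1 ex} h1 h2 => [k|q]; first by case: ifP => _ -> ->.
  by case: (rho q) => -> ->.
- by have := i2 K1.+1.
- by have := i1 K2.+1.
- by case: h1 => -[? ->]; case: h2 => -[? ->].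
Qed.

Lemma denotes_exists t : exists o, denotes (run t) o.
Proof.
have [inf|] := pselect (forall k, run t k <> None).
  have [mp|mp] := pselect (mp_ok (fun j => wt_of (run t j))).
  - by exists (EWin R n); right; split => //; left.
  - by exists (AWin R n); right; split => //; right.
move=> /existsNP[k] /contrapT kN.
have [K KS KN] : exists2 K, run t K <> None & run t K.+1 = None.
  elim: k kN => // k IH kN.
  by have [|kS] := pselect (run t k = None); [exact: IH|exists k].
case E : (run t K) KS => [[i|q]|] // _.
- exists (if K == 0%N then Exit R i else WExit (\sum_(j < K) wt_of (run t j)) i).
  by left; exists K, (inl i); do 2 split => //; case: (K == 0)%N.
- exists (match rho q with Fa => EWin R n | Ex => AWin R n end).
  by left; exists K, (inr q); do 2 split => //; case: (rho q).
Qed.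

Definition outf t : outc R n := sval (cid (denotes_exists t)).

Lemma outfP t : denotes (run t) (outf t).
Proof. by rewrite /outf; case: cid. Qed.

Lemma outf_eq t o : denotes (run t) o -> outf t = o.
Proof. exact: denotes_unique (outfP t). Qed.

(** The effect of a visited weight on an outcome: an exit becomes a weighted one even if [r] is [0],
    and a decided play stays decided. *)
Definition wadd p (r : R) (o : outc R p) : outc R p :=
  match o with
  | Exit k => WExit r k
  | WExit r' k => WExit (r + r') k
  | EWin => EWin R p
  | AWin => AWin R p
  end.

Lemma outf_exit i : outf (inl i) = Exit R i.
Proof. by apply: outf_eq; left; exists 0%N, (inl i). Qed.

Lemma outf_dead q : nx q = None ->
  outf (inr q) = match rho q with Fa => EWin R n | Ex => AWin R n end.
Proof.
move=> qN; apply: outf_eq; left; exists 0%N, (inr q); do 2 split => //.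
by case: (rho q).
Qed.

(** In a finite run the first weight splits off the sum; in an infinite run it does not affect the
    mean payoff, by [mp_shift]. *)
Lemma outf_step q t : nx q = Some t -> outf (inr q) = wadd (wt q) (outf t).
Proof.
move=> qt; apply: outf_eq.
have runS k := run_step k qt.
have [[K [x [xK [KN ox]]]]|[inf win]] := outfP t; [left|right].
- exists K.+1, x; rewrite !runS; do 2 split => //.
  case: x xK ox => [i|q'] xK; last by case: (rho q') => ->.
  case: K xK KN => [|K] xK KN /= -> /=.
    by rewrite big_ord1.
  rewrite [in RHS]big_ord_recl; congr (WExit (_ + _) _).
  by apply: eq_bigr => j _; rewrite runS.
- split; first by case=> // k; rewrite runS.
  have mpE : mp_ok (fun j => wt_of (run (inr q) j)) <-> mp_ok (fun j => wt_of (run t j)).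
    rewrite -mp_shift; have -> // :
      (fun j => wt_of (run (inr q) j.+1)) = (fun j => wt_of (run t j)).
    by apply/funext => j; rewrite runS.
  by case: win => -[/mpE mp ->]; [left|right].
Qed.

Lemma outf_inf t : (forall k, run t k <> None) ->
  outf t = if pselect (mp_ok (fun j => wt_of (run t j))) then EWin R n else AWin R n.
Proof. by move=> inf; apply: outf_eq; right; split => //; case: pselect; [left|right]. Qed.

(** The finite runs as an inductive predicate, so that [outf_exit], [outf_dead] and [outf_step]
    become the cases of an induction. *)
Inductive halts : vtx A -> Prop :=
| halts_exit i : halts (inl i)
| halts_dead q : nx q = None -> halts (inr q)
| halts_step q t : nx q = Some t -> halts t -> halts (inr q).

Lemma halts_or_inf t : halts t \/ forall k, run t k <> None.
Proof.
have [inf|] := pselect (forall k, run t k <> None); [by right|].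
move=> /existsNP[k] /contrapT kN; left; elim: k t kN => // k IH [i _|q]; first exact: halts_exit.
case E : (nx q) => [t|]; last by move=> _; exact: halts_dead.
by rewrite (run_step _ E) => /IH; exact: halts_step.
Qed.

(** If an exit is reached, [c] counts the positions visited before it. These counts are the block
    lengths in the trace, and they locate the predecessor of an exit in [W_isSr]. *)
Lemma exit_time t : exists c : nat, forall k,
  (outf t = Exit R k -> c = 0%N /\ t = inl k) /\
  (forall r, outf t = WExit r k ->
     [/\ (0 < c)%N, run t c = Some (inl k) & r = \sum_(j < c) wt_of (run t j)]).
Proof.
have [[K [x [xK [KN ox]]]]|[_ win]] := outfP t; last first.
  by exists 0%N => k; case: win => -[_ ->]; split.
case: x xK ox => [i|q] xK; last by case: (rho q) => ->; exists 0%N => k; split.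
case: (posnP K) => [K0|K0] ->.
- exists 0%N => k; split=> [[<-]|//]; split=> //.
  by move: xK; rewrite K0 /= => -[].
- by exists K => k; split=> // r [<- <-].
Qed.

End Outcome.

(** * Simulations and transfer of strategies *)

Definition orel (T T' : Type) (P : T -> T' -> Prop) (o : option T) (o' : option T') : Prop :=
  match o, o' with Some t, Some t' => P t t' | None, None => True | _, _ => False end.

Section Simulation.
Variables (R : realType) (m n m' n' : nat) (A : roMPG R m n) (C : roMPG R m' n').
Variables (nxA : pos A -> option (vtx A)) (nxC : pos C -> option (vtx C)).
Variables (e : pos A -> pos C) (S : vtx A -> vtx C -> Prop).
Hypothesis rho_e : forall q, rho (e q) = rho q.
Hypothesis wt_e : forall q, wt (e q) = wt q.
Hypothesis S_pos : forall q t', S (inr q) t' -> t' = inr (e q).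
Hypothesis S_step : forall q, orel S (nxA q) (nxC (e q)).

Lemma run_sim t t' k u : S t t' -> run nxA t k = Some u ->
  exists2 u', run nxC t' k = Some u' & S u u'.
Proof.
move=> tt'; elim: k u => [|k IH] u /=; first by move=> [<-]; exists t'.
case E : (run nxA t k) IH => [[//|q]|//] /(_ _ erefl)[_ -> /S_pos ->] qu.
by have := S_step q; rewrite qu; case: (nxC (e q)) => // u' uu'; exists u'.
Qed.

(** The run has to go on after [k] because [S] may relate an exit of [A] to a position of [C], whose
    weight is arbitrary. *)
Lemma wt_sim t t' k : S t t' -> run nxA t k.+1 <> None ->
  wt_of (run nxC t' k) = wt_of (run nxA t k).
Proof.
move=> tt' /=; case E : (run nxA t k) => [[//|q]|//] _.
by have [_ -> /S_pos ->] := run_sim tt' E; rewrite /= wt_e.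
Qed.

(** Finite runs go by induction on [halts]; an infinite run has the same weight sequence in both
    games. As [S] is only a relation, the target [u] where the second run goes on is existentially
    quantified. *)
Lemma outf_sim t t' : S t t' ->
  match outf nxA t with
  | Exit k => exists2 u, S (inl k) u & outf nxC t' = outf nxC u
  | WExit r k => exists2 u, S (inl k) u & outf nxC t' = wadd r (outf nxC u)
  | EWin => outf nxC t' = EWin R n'
  | AWin => outf nxC t' = AWin R n'
  end.
Proof.
have [ht|inf] := halts_or_inf nxA t.
  elim: ht t' => {t} [i|q qN|q t qt _ IH] t'.
  - by rewrite outf_exit; exists t'.
  - move=> /S_pos ->; have := S_step q; rewrite qN.
    case E : (nxC (e q)) => // _; rewrite (outf_dead qN) (outf_dead E) rho_e.
    by case: (rho q).
  - move=> /S_pos ->; have := S_step q; rewrite qt.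
    case E : (nxC (e q)) => [t''|//] /IH; rewrite (outf_step qt) (outf_step E) wt_e.
    case: (outf nxA t) => [k [u ku ->]|r k [u ku ->]| -> | ->] //=; exists u => //.
    by case: (outf nxC u) => //= r' k'; rewrite addrA.
move=> tt'.
have infC k : run nxC t' k <> None.
  by have := inf k; case E : (run nxA t k) => // _; have [? ->] := run_sim tt' E.
rewrite (outf_inf inf) (outf_inf infC).
have -> : (fun j => wt_of (run nxC t' j)) = (fun j => wt_of (run nxA t j)).
  by apply/funext => j; apply: wt_sim.
by case: pselect.
Qed.

End Simulation.

(** Kleisli extension for the monad of outcomes; [compSP] is its composition, see [compSP_bnd]. *)
Definition obnd (R : realType) n p (o : outc R n) (g : 'I_n -> outc R p) : outc R p :=
  match o with
  | Exit k => g k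
  | WExit r k => wadd r (g k)
  | EWin => EWin R p
  | AWin => AWin R p
  end.

Lemma outf_sim_fun (R : realType) (m n m' n' : nat) (A : roMPG R m n) (C : roMPG R m' n')
    (nxA : pos A -> option (vtx A)) (nxC : pos C -> option (vtx C))
    (e : pos A -> pos C) (h : vtx A -> vtx C) :
  (forall q, rho (e q) = rho q) -> (forall q, wt (e q) = wt q) ->
  (forall q, h (inr q) = inr (e q)) ->
  (forall q, orel (fun t t' => t' = h t) (nxA q) (nxC (e q))) ->
  forall t, outf nxC (h t) = obnd (outf nxA t) (fun k => outf nxC (h (inl k))).
Proof.
move=> rhoe wte hpos hstep t.
have hposS q t' : t' = h (inr q) -> t' = inr (e q) by rewrite hpos.
have := outf_sim rhoe wte hposS hstep (erefl (h t)).
by case: (outf nxA t) => [k [_ -> //]|r k [_ -> //]| |].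
Qed.

Section Strategies.
Variables (R : realType) (m n m' n' : nat) (A : roMPG R m n) (C : roMPG R m' n').

(* [strategy r tau] is, by definition, [forall q, move_ok r q (tau q)]. *)
Definition move_ok (r : role) (q : pos A) (o : option (vtx A)) : Prop :=
  (rho q = r ->
     ((exists t, edge (inr q) t) <-> o <> None) /\
     (forall t, o = Some t -> edge (inr q) t)) /\
  (rho q <> r -> o = None).

Definition nxt (tE tF : pos A -> option (vtx A)) (q : pos A) : option (vtx A) :=
  match rho q with Ex => tE q | Fa => tF q end.

Lemma strategy_exists r : exists tau, strategy (A := A) r tau.
Proof.
suff /choice[tau Htau] : forall q, exists o, move_ok r q o by exists tau.
move=> q; have [rq|rq] := pselect (rho q = r); last by exists None; split.
have [[t qt]|no] := pselect (exists t, edge (inr q) t).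
- by exists (Some t); split=> // _; split=> [|_ [<-]//]; split=> // _; exists t.
- by exists None.
Qed.

Lemma nxt_edge tE tF q t : strategy Ex tE -> strategy Fa tF ->
  nxt tE tF q = Some t -> edge (inr q) t.
Proof.
move=> sE sF; rewrite /nxt; case E : (rho q).
- by have [/(_ E)[_ val] _] := sE q; exact: val.
- by have [/(_ E)[_ val] _] := sF q; exact: val.
Qed.

Definition plays (tE tF : pos A -> option (vtx A)) (f : SParrow R m n) : Prop :=
  forall i, exists2 t, edge (inl i) t & f i = outf (nxt tE tF) t.

(** An induced play is the run from the target of the entrance's edge, so its denotation can be
    computed by [outf]. *)
Lemma W_plays : W A = [set H | exists tE, SigmaE tE /\
  H = [set f | exists tF, SigmaF tF /\ plays tE tF f]].
Proof.
have inducedP tE tF (i : 'I_m) (o : outc R n) :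
    (exists s, induced tE tF i s /\ denotes s o) <->
    exists2 t, edge (inl i) t & o = outf (nxt tE tF) t.
  split=> [[s [[s0 sS] so]]|[t it ->]]; last first.
    by exists (run (nxt tE tF) t); split; [split|exact: outfP].
  (* A play that ends at its entrance denotes nothing, since both cases of [denotes] require an
     entry. *)
  case s0E : (s 0%N) s0 => [t|] st; last first.
    have sN k : s k = None by elim: k => // k IH; rewrite sS IH.
    by case: so => [[K [x []]]|[/(_ 0%N)]]; rewrite sN.
  exists t => //; apply/esym/outf_eq.
  suff -> : run (nxt tE tF) t = s by [].
  by apply/funext => k; elim: k => [|k /= ->] //=; rewrite sS.
rewrite /W; congr mkset; apply/funext => H; congr ex; apply/funext => tE.
congr (_ /\ _ = _); congr mkset; apply/funext => f; congr ex; apply/funext => tF.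
by congr (_ /\ _); apply/propext; split=> p i; apply/inducedP.
Qed.

End Strategies.

Section Transfer.
Variables (R : realType) (m n m' n' : nat) (A : roMPG R m n) (C : roMPG R m' n').
Variables (q : pos A) (q' : pos C) (S : vtx A -> vtx C -> Prop).
Hypothesis rho_q : rho q' = rho q.
Hypothesis edge_q : forall t', edge (inr q') t' <-> exists2 t, edge (inr q) t & S t t'.
Hypothesis S_total : forall t, edge (inr q) t -> exists t', S t t'.

(** The moves from [q'] are the [S]-images of the moves from [q], and each move from [q] has an
    image. Hence one position is stuck iff the other is, and a choice at either yields a related
    choice at the other. *)
Lemma move_ok_push r o : move_ok r q o -> exists2 o', move_ok r q' o' & orel S o o'.
Proof.
move=> [own other]; have [rq|rq] := pselect (rho q = r); last first.
  by exists None; [split; rewrite rho_q|rewrite (other rq)].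
have [ex val] := own rq; case: o {own other} ex val => [t|] ex val.
- have qt := val _ erefl; have [t' tt'] := S_total qt.
  have qt' : edge (inr q') t' by apply/edge_q; exists t.
  exists (Some t') => //; split; rewrite rho_q// => _.
  by split=> [|_ [<-]//]; split=> // _; exists t'.
- exists None => //; split=> // _; split=> //; split=> // -[t' /edge_q[t qt _]].
  by case: ex => /(_ (ex_intro _ t qt)).
Qed.

Lemma move_ok_pull r o' : move_ok r q' o' -> exists2 o, move_ok r q o & orel S o o'.
Proof.
rewrite /move_ok rho_q => -[own other].
have [rq|rq] := pselect (rho q = r); last first.
  by exists None; [split|rewrite (other rq)].
have [ex val] := own rq; case: o' {own other} ex val => [t'|] ex val.
- have /edge_q[t qt tt'] := val _ erefl; exists (Some t) => //; split=> // _.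
  by split=> [|_ [<-]//]; split=> // _; exists t.
- exists None => //; split=> // _; split=> //; split=> // -[t qt].
  have [t' tt'] := S_total qt.
  have qt' : edge (inr q') t' by apply/edge_q; exists t.
  by case: ex => /(_ (ex_intro _ t' qt')).
Qed.

End Transfer.

Lemma orel_nxt (R : realType) (m n m' n' : nat) (A : roMPG R m n) (C : roMPG R m' n')
    (S : vtx A -> vtx C -> Prop) tE tF tE' tF' (q : pos A) (q' : pos C) :
  rho q' = rho q -> orel S (tE q) (tE' q') -> orel S (tF q) (tF' q') ->
  orel S (nxt tE tF q) (nxt tE' tF' q').
Proof. by rewrite /nxt => ->; case: (rho q). Qed.

(** Both levels of sets range over strategies of one player, so a matching [M] that is total in both
    directions transfers them one after the other. [op] is a relation because [trSP] is one. *)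
Lemma W_image1 (R : realType) (m1 n1 m n : nat) (A : roMPG R m1 n1) (C : roMPG R m n)
    (op : SParrow R m1 n1 -> SParrow R m n -> Prop)
    (M : (pos A -> option (vtx A)) -> (pos C -> option (vtx C)) -> Prop) :
  (forall r tA, strategy r tA -> exists2 tC, strategy r tC & M tA tC) ->
  (forall r tC, strategy r tC -> exists2 tA, strategy r tA & M tA tC) ->
  (forall tEA tFA tEC tFC, strategy Ex tEA -> strategy Fa tFA ->
     strategy Ex tEC -> strategy Fa tFC -> M tEA tEC -> M tFA tFC ->
     forall h, plays tEC tFC h <-> exists2 f, plays tEA tFA f & op f h) ->
  W C = [set H | exists F', W A F' /\ H = [set h | exists f, F' f /\ op f h]].
Proof.
move=> push pull playsP; rewrite !W_plays.
have inner tEA tEC : strategy Ex tEA -> strategy Ex tEC -> M tEA tEC ->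
    [set h | exists tF, SigmaF tF /\ plays tEC tF h] =
    [set h | exists f, (exists tF, SigmaF tF /\ plays tEA tF f) /\ op f h].
  move=> sA sC ME; apply/seteqP; split=> h /=.
  - move=> [tFC [sFC ph]]; have [tFA sFA MF] := pull _ _ sFC.
    have /playsP := ph; move=> /(_ _ _ sA sFA sC sFC ME MF)[f pf fh].
    by exists f; split=> //; exists tFA.
  - move=> [f [[tFA [sFA pf]] fh]]; have [tFC sFC MF] := push _ _ sFA.
    exists tFC; split=> //; apply/(playsP _ _ _ _ sA sFA sC sFC ME MF).
    by exists f.
apply/seteqP; split=> H /=.
- move=> [tEC [sC ->]]; have [tEA sA ME] := pull _ _ sC.
  exists [set f | exists tF, SigmaF tF /\ plays tEA tF f].
  by split; [exists tEA|exact: inner].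
- move=> [_ [[tEA [sA ->]] ->]]; have [tEC sC ME] := push _ _ sA.
  by exists tEC; split=> //; rewrite (inner tEA).
Qed.

(** The binary version: a strategy of [C] corresponds to an independent pair of strategies, as in
    the products of sets in [compS] and [sumS]. *)
Lemma W_image2 (R : realType) (m1 n1 m2 n2 m n : nat) (A : roMPG R m1 n1)
    (B : roMPG R m2 n2) (C : roMPG R m n)
    (op : SParrow R m1 n1 -> SParrow R m2 n2 -> SParrow R m n)
    (M : (pos A -> option (vtx A)) -> (pos B -> option (vtx B)) ->
         (pos C -> option (vtx C)) -> Prop) :
  (forall r tA tB, strategy r tA -> strategy r tB -> exists2 tC, strategy r tC & M tA tB tC) ->
  (forall r tC, strategy r tC -> exists tA tB, [/\ strategy r tA, strategy r tB & M tA tB tC]) ->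
  (forall tEA tFA tEB tFB tEC tFC, M tEA tEB tEC -> M tFA tFB tFC ->
     forall h, plays tEC tFC h <->
       exists f g, [/\ plays tEA tFA f, plays tEB tFB g & h = op f g]) ->
  W C = [set H | exists F' G', W A F' /\ W B G' /\
     H = [set h | exists f g, F' f /\ G' g /\ h = op f g]].
Proof.
move=> push pull playsP; rewrite !W_plays.
have inner tEA tEB tEC : M tEA tEB tEC ->
    [set h | exists tF, SigmaF tF /\ plays tEC tF h] =
    [set h | exists f g, (exists tF, SigmaF tF /\ plays tEA tF f) /\
       (exists tF, SigmaF tF /\ plays tEB tF g) /\ h = op f g].
  move=> ME; apply/seteqP; split=> h /=.
  - move=> [tFC [sFC ph]]; have [tFA [tFB [sFA sFB MF]]] := pull _ _ sFC.
    have /playsP := ph; move=> /(_ _ _ _ _ ME MF)[f [g [pf pg ->]]].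
    by exists f, g; split; [exists tFA|split=> //; exists tFB].
  - move=> [f [g [[tFA [sFA pf]] [[tFB [sFB pg]] ->]]]].
    have [tFC sFC MF] := push _ _ _ sFA sFB.
    by exists tFC; split=> //; apply/(playsP _ _ _ _ _ _ ME MF); exists f, g.
apply/seteqP; split=> H /=.
- move=> [tEC [sC ->]]; have [tEA [tEB [sA sB ME]]] := pull _ _ sC.
  exists [set f | exists tF, SigmaF tF /\ plays tEA tF f].
  exists [set g | exists tF, SigmaF tF /\ plays tEB tF g].
  by split; [exists tEA|split; [exists tEB|exact: inner]].
- move=> [_ [_ [[tEA [sA ->]] [[tEB [sB ->]] ->]]]].
  have [tEC sC ME] := push _ _ _ sA sB.
  by exists tEC; split=> //; rewrite (inner tEA tEB).
Qed.

(** * Values, isomorphism, composition and monoidal product *)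

Section Entries.
Variables (R : realType) (m n : nat) (A : roMPG R m n).

Lemma wf_entry : wf A ->
  exists S : 'I_m -> vtx A, forall i t, edge (inl i) t <-> t = S i.
Proof.
move=> [ent _]; have [S HS] := choice ent.
exists S => i t; have [iS uniq] := HS i.
by split=> [/uniq ->|->].
Qed.

Lemma plays_entry (S : 'I_m -> vtx A) tE tF f : (forall i t, edge (inl i) t <-> t = S i) ->
  plays tE tF f <-> f = (fun i => outf (nxt tE tF) (S i)).
Proof.
move=> HS; split=> [pf|-> i]; last by exists (S i) => //; apply/HS.
by apply/funext => i; have [t /HS -> ->] := pf i.
Qed.

Lemma finite_strategies : finite_set [set: pos A -> option (vtx A)].
Proof.
have -> : [set: pos A -> option (vtx A)] =
    (fun (g : {ffun pos A -> option ('I_n + pos A)}) q => g q) @` setT.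
  by apply/seteqP; split=> // f _; exists [ffun q => f q] => //; apply/funext => q; rewrite ffunE.
by apply: finite_image; exact: finite_finset.
Qed.

(** Finiteness comes from the finitely many strategies. For validity, an unweighted exit has the
    entrance as its only predecessor; a second way to reach it would provide another entrance or a
    position as predecessor. *)
Lemma W_isSr : wf A -> isSr (W A).
Proof.
move=> wfA; have [S HS] := wf_entry wfA; have [_ pred_uniq] := wfA.
rewrite W_plays; split.
  apply: (@sub_finite_set _ _
    ((fun tE => [set f | exists tF, SigmaF tF /\ plays tE tF f]) @` setT)).
    by move=> H [tE [_ ->]]; exists tE.
  by apply: finite_image; exact: finite_strategies.
move=> _ [tE [sE ->]]; split.
  apply: (@sub_finite_set _ _ ((fun tF i => outf (nxt tE tF) (S i)) @` setT)).
    by move=> f [tF [_ /(plays_entry _ _ _ HS) ->]]; exists tF.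
  by apply: finite_image; exact: finite_strategies.
move=> _ [tF [sF /(plays_entry _ _ _ HS) ->]] i j k r neq fi.
have ik : edge (r := A) (inl i) (inl k).
  by apply/HS/esym; have [c /(_ k)[/(_ fi)[]]] := exit_time (nxt tE tF) (S i).
have [c /(_ k)[fjE fjW]] := exit_time (nxt tE tF) (S j); split=> [/fjE[_ Sj]|/fjW[]].
  have jk : edge (r := A) (inl j) (inl k) by apply/HS.
  by apply: neq; have [] := pred_uniq _ _ _ ik jk.
(* A weighted exit is reached after at least one position, and the last one precedes it. *)
case: c fjE fjW => // c _ _ _ /=.
case: (run _ _ c) => [[//|q]|//] /(nxt_edge sE sF) qk _.
by have := pred_uniq _ _ _ ik qk.
Qed.

End Entries.

Lemma W_direct (R : realType) m n (C : roMPG R m n) (S : 'I_m -> 'I_n) :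
  (forall i t, edge (r := C) (inl i) t <-> t = inl (S i)) ->
  W C = [set [set fun i => Exit R (S i)]].
Proof.
move=> HS; rewrite W_plays.
have playsP tE tF f : plays (A := C) tE tF f <-> f = (fun i => Exit R (S i)).
  have <- : (fun i => outf (nxt tE tF) (inl (S i))) = (fun i => Exit R (S i)).
    by apply/funext => i; rewrite outf_exit.
  exact: (plays_entry (A := C) tE tF f HS).
(* Strategies do not influence the plays here, but some must exist for the sets to be inhabited. *)
have [tE0 sE0] := strategy_exists C Ex; have [tF0 sF0] := strategy_exists C Fa.
have inner tE : [set f | exists tF, SigmaF tF /\ plays (A := C) tE tF f] =
    [set fun i => Exit R (S i)].
  apply/seteqP; split=> f /=; first by move=> [tF [_ /playsP]].
  by move=> /(playsP tE tF0) pf; exists tF0.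
apply/seteqP; split=> H /=; first by move=> [tE [_ ->]].
by move=> ->; exists tE0.
Qed.

Lemma W_idG (R : realType) m : W (idG R m) = @idS R m.
Proof.
rewrite (@W_direct _ _ _ (idG R m) id)//.
by move=> i [j|[]] /=; split=> [->|[->]].
Qed.

Lemma W_symG (R : realType) m n : W (symG R m n) = @symS R m n.
Proof.
rewrite (@W_direct _ _ _ (symG R m n)
  (fun i => match fintype.split i with inl a => rshift n a | inr b => lshift m b end)).
- congr set1; congr set1; apply/funext => i; rewrite /symSP.
  by case: (fintype.split i).
- by move=> i [j|[]] /=; case: (fintype.split i) => a; split=> [->|[->]].
Qed.

Lemma W_iso (R : realType) m n (A B : roMPG R m n) : iso A B -> W A = W B.
Proof.
move=> [h [[h' hK h'K] [hedge [hrho hwt]]]].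
have liftK (k : nat) : cancel (@liftQ 'I_k _ _ h) (liftQ h') by case=> //= q; rewrite hK.
have liftK' (k : nat) : cancel (@liftQ 'I_k _ _ h') (liftQ h) by case=> //= q; rewrite h'K.
have edgeP s t' : edge (r := B) (liftQ h s) t' <-> exists2 t, edge (r := A) s t & t' = liftQ h t.
  split=> [e|[t e ->]]; last by apply/hedge.
  by exists (liftQ h' t'); [apply/hedge|]; rewrite liftK'.
pose M (tA : pos A -> option (vtx A)) (tB : pos B -> option (vtx B)) :=
  forall q, orel (fun t t' => t' = liftQ h t) (tA q) (tB (h q)).
have total q t : edge (r := A) (inr q) t -> exists t', t' = liftQ h t by exists (liftQ h t).
rewrite [RHS](@W_image1 R m n m n A B (fun f g => g = f) M).
(* [W A] is its own image under equality, which brings the claim into the form of [W_image1]. *)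
- have -> : (fun H => exists F', W A F' /\ H = [set g | exists f, F' f /\ g = f]) = W A => //.
  have idE (F' : set (SParrow R m n)) : [set g | exists f, F' f /\ g = f] = F'.
    by apply/seteqP; split=> [_ [f [Ff ->]]//|f Ff]; exists f.
  apply/seteqP; split=> [H [F' [WF ->]]|F' WF]; first by rewrite idE.
  by exists F'; rewrite idE.
- move=> r tA sA.
  have /choice[tB HtB] : forall q', exists o', move_ok r q' o' /\
      orel (fun t t' => t' = liftQ h t) (tA (h' q')) o'.
    move=> q'.
    have rhoq : rho q' = rho (h' q') by rewrite -hrho h'K.
    have edgeq t' := edgeP (inr (h' q')) t'; rewrite /= h'K in edgeq.
    by have [o' ok oo'] := move_ok_push rhoq edgeq (@total _) (sA (h' q')); exists o'.
  exists tB; first by move=> q'; have [] := HtB q'.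
  by move=> q; have [_] := HtB (h q); rewrite hK.
- move=> r tB sB.
  have /choice[tA HtA] : forall q, exists o, move_ok r q o /\
      orel (fun t t' => t' = liftQ h t) o (tB (h q)).
    move=> q.
    have [o ok oo'] := move_ok_pull (hrho q) (edgeP (inr q)) (@total _) (sB (h q)).
    by exists o.
  by exists tA => q; have [] := HtA q.
- move=> tEA tFA tEB tFB _ _ _ _ ME MF f.
  have outE t : outf (nxt tEB tFB) (liftQ h t) = outf (nxt tEA tFA) t.
    rewrite (outf_sim_fun (e := h) (nxA := nxt tEA tFA)) //.
      by case: (outf _ t) => //= [k|r k]; rewrite outf_exit.
    by move=> q; apply: orel_nxt.
  split=> [pf|[g pg ->] i].
  + exists f => // i; have [t' e ->] := pf i.
    by have /(edgeP (inl i))[t it ->] := e; exists t; rewrite ?outE.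
  + have [t it ->] := pg i; exists (liftQ h t); last by rewrite outE.
    by apply/(edgeP (inl i)); exists t.
Qed.

(** * Games on a disjoint union of positions *)

Section Juxtaposition.
Variables (R : realType) (m1 n1 m2 n2 m n : nat).
Variables (A : roMPG R m1 n1) (B : roMPG R m2 n2).
Variable ed : 'I_m + (pos A + pos B) -> 'I_n + (pos A + pos B) -> Prop.
Let C : roMPG R m n := @MkRoMPG R m n (pos A + pos B)%type ed
  (fun q => match q with inl q => rho q | inr q => rho q end)
  (fun q => match q with inl q => wt q | inr q => wt q end).
Variables (hA : vtx A -> vtx C) (hB : vtx B -> vtx C).
Variables (SA : 'I_m1 -> vtx A) (SB : 'I_m2 -> vtx B) (SC : 'I_m -> vtx C).
Variable op : SParrow R m1 n1 -> SParrow R m2 n2 -> SParrow R m n.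
Hypothesis hA_pos : forall q, hA (inr q) = inr (inl q).
Hypothesis hB_pos : forall q, hB (inr q) = inr (inr q).
Hypothesis edA : forall q t', ed (inr (inl q)) t' <-> exists2 t, edge (inr q) t & t' = hA t.
Hypothesis edB : forall q t', ed (inr (inr q)) t' <-> exists2 t, edge (inr q) t & t' = hB t.
Hypothesis SAP : forall i t, edge (inl i) t <-> t = SA i.
Hypothesis SBP : forall i t, edge (inl i) t <-> t = SB i.
Hypothesis SCP : forall i t, ed (inl i) t <-> t = SC i.
Hypothesis opP : forall nA nB nC,
  (forall t, outf nC (hA t) = obnd (outf nA t) (fun k => outf nC (hA (inl k)))) ->
  (forall t, outf nC (hB t) = obnd (outf nB t) (fun k => outf nC (hB (inl k)))) ->
  forall i, outf nC (SC i) = op (fun j => outf nA (SA j)) (fun j => outf nB (SB j)) i.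

(** Common to composition and monoidal product, which differ in the maps [hA] and [hB] telling where
    an edge target of a component lies in [C], in the entry targets [SC], and in the operation
    [op]. *)
Lemma W_juxtaposition : W C = [set H | exists F' G', W A F' /\ W B G' /\
  H = [set h | exists f g, F' f /\ G' g /\ h = op f g]].
Proof.
pose M (tA : pos A -> option (vtx A)) (tB : pos B -> option (vtx B))
    (tC : pos C -> option (vtx C)) :=
  (forall q, orel (fun t t' => t' = hA t) (tA q) (tC (inl q))) /\
  (forall q, orel (fun t t' => t' = hB t) (tB q) (tC (inr q))).
have totA q t : edge (r := A) (inr q) t -> exists t', t' = hA t by exists (hA t).
have totB q t : edge (r := B) (inr q) t -> exists t', t' = hB t by exists (hB t).
apply: (W_image2 (M := M)).
- move=> r tA tB sA sB.
  have /choice[tA' HA] : forall q, exists o', move_ok (A := C) r (inl q) o' /\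
      orel (fun t t' => t' = hA t) (tA q) o'.
    move=> q; have [o' ? ?] :=
      @move_ok_push _ _ _ _ _ A C q (inl q) _ erefl
        (edA q) (totA q) r _ (sA q).
    by exists o'.
  have /choice[tB' HB] : forall q, exists o', move_ok (A := C) r (inr q) o' /\
      orel (fun t t' => t' = hB t) (tB q) o'.
    move=> q; have [o' ? ?] :=
      @move_ok_push _ _ _ _ _ B C q (inr q) _ erefl
        (edB q) (totB q) r _ (sB q).
    by exists o'.
  exists (fun q => match q with inl q => tA' q | inr q => tB' q end).
    by case=> q; [have [] := HA q|have [] := HB q].
  by split=> q; [have [] := HA q|have [] := HB q].
- move=> r tC sC.
  have /choice[tA HA] : forall q, exists o, move_ok (A := A) r q o /\
      orel (fun t t' => t' = hA t) o (tC (inl q)).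
    move=> q; have [o ? ?] :=
      @move_ok_pull _ _ _ _ _ A C q (inl q) _ erefl
        (edA q) (totA q) r _ (sC (inl q)).
    by exists o.
  have /choice[tB HB] : forall q, exists o, move_ok (A := B) r q o /\
      orel (fun t t' => t' = hB t) o (tC (inr q)).
    move=> q; have [o ? ?] :=
      @move_ok_pull _ _ _ _ _ B C q (inr q) _ erefl
        (edB q) (totB q) r _ (sC (inr q)).
    by exists o.
  exists tA, tB; split; [by move=> q; case: (HA q)|by move=> q; case: (HB q)|].
  by split=> q; [case: (HA q)|case: (HB q)].
- move=> tEA tFA tEB tFB tEC tFC [MEA MEB] [MFA MFB] h.
  have outA := outf_sim_fun (A := A) (C := C) (e := inl) (h := hA)
    (fun=> erefl) (fun=> erefl) hA_pos
    (fun q => orel_nxt (A := A) (C := C) (q' := inl q) erefl (MEA q) (MFA q)).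
  have outB := outf_sim_fun (A := B) (C := C) (e := inr) (h := hB)
    (fun=> erefl) (fun=> erefl) hB_pos
    (fun q => orel_nxt (A := B) (C := C) (q' := inr q) erefl (MEB q) (MFB q)).
  have outC := opP outA outB.
  have playsC f := plays_entry (A := C) tEC tFC f SCP.
  split=> [/playsC ->|[f [g [pf pg ->]]]].
    exists (fun j => outf (nxt tEA tFA) (SA j)), (fun j => outf (nxt tEB tFB) (SB j)).
    by split; [exact/(plays_entry _ _ _ SAP)|exact/(plays_entry _ _ _ SBP)|exact/funext].
  rewrite ((plays_entry _ _ _ SAP).1 pf) ((plays_entry _ _ _ SBP).1 pg).
  by apply/playsC/esym/funext.
Qed.

End Juxtaposition.

Lemma compSP_bnd (R : realType) m l n (f : SParrow R m l) (g : SParrow R l n) i :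
  compSP f g i = obnd (f i) g.
Proof. by rewrite /compSP; case: (f i) => //= r j; case: (g j). Qed.

Lemma W_compG (R : realType) m l n (A : roMPG R m l) (B : roMPG R l n) :
  wf A -> wf B -> W (compG A B) = compS (W A) (W B).
Proof.
move=> /wf_entry[SA SAP] /wf_entry[SB SBP].
pose hB (t : vtx B) : vtx (compG A B) :=
  match t with inl k => inl k | inr q => inr (inr q) end.
(* An exit [j] of [A] is fused with entrance [j] of [B], hence replaced by the unique target of that
   entrance. *)
pose hA (t : vtx A) : vtx (compG A B) :=
  match t with inl j => hB (SB j) | inr q => inr (inl q) end.
have tgtB_h t' b : tgtB t' = Some b <-> t' = hB b.
  by split=> [|->]; [case: t' => [k|[q|q]] //= [<-]|case: b].
have edgeA s a t' : srcA s = Some a -> srcB s = None ->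
    (comp_edge s t' <-> exists2 t, edge a t & t' = hA t).
  move=> sa sN; split.
  - move=> [[a0 [q [+ [+ e]]]]|[[q [b [+ _]]]|[a0 [b [j [+ [+ [e e']]]]]]]].
    + by rewrite sa => -[->]; case: t' => [//|[q'|//]] [->]; exists (inr q).
    + by rewrite sN.
    + by rewrite sa => -[->] /tgtB_h ->; exists (inl j) => //=; rewrite -((SBP _ _).1 e').
  - move=> [[j|q] e ->]; last by left; exists a, q.
    by right; right; exists a, (SB j), j; do !split => //; [exact/tgtB_h|exact/SBP].
apply: (@W_juxtaposition R m l l n m n A B _ hA hB SA SB
  (fun i => hA (SA i)) (@compSP R m l n)) => //.
- by move=> q t'; apply: edgeA.
- move=> q t'; split.
  + move=> [[? [? [//]]]|[[? [b [[<-] [/tgtB_h -> e]]]]|[? [? [? [//]]]]]]; by exists b.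
  + by move=> [b e ->]; right; left; exists q, b; do !split => //; exact/tgtB_h.
- move=> i t'; rewrite (@edgeA _ (inl i))//.
  by split=> [[t /SAP -> //]|->]; exists (SA i) => //; exact/SAP.
- move=> nA nB nC outA outB i; rewrite compSP_bnd outA; congr obnd; apply/funext => k /=.
  rewrite outB; case: (outf nB (SB k)) => //= [k'|r k']; by rewrite outf_exit.
Qed.

Lemma omap_out_bnd (R : realType) n p (h : 'I_n -> 'I_p) (o : outc R n) :
  omap_out h o = obnd o (fun k => Exit R (h k)).
Proof. by case: o. Qed.

Lemma W_sumG (R : realType) m n k l (A : roMPG R m n) (B : roMPG R k l) :
  wf A -> wf B -> W (sumG A B) = sumS (W A) (W B).
Proof.
move=> /wf_entry[SA SAP] /wf_entry[SB SBP].
pose hA (t : vtx A) : vtx (sumG A B) :=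
  match t with inl j => inl (lshift l j) | inr q => inr (inl q) end.
pose hB (t : vtx B) : vtx (sumG A B) :=
  match t with inl j => inl (rshift n j) | inr q => inr (inr q) end.
have splitl a b (i : 'I_a) : fintype.split (lshift b i) = inl i := unsplitK (inl i).
have splitr a b (i : 'I_b) : fintype.split (rshift a i) = inr i := unsplitK (inr i).
have tgtA s : sum_tgt (A := A) (B := B) (hA s) = inl s by case: s => //= i; rewrite splitl.
have tgtB s : sum_tgt (A := A) (B := B) (hB s) = inr s by case: s => //= i; rewrite splitr.
have tgtP t' : (exists t, t' = hA t) \/ (exists t, t' = hB t).
  case: t' => [i|[q|q]]; [|by left; exists (inr q)|by right; exists (inr q)].
  by case: (split_ordP i) => j ->; [left; exists (inl j)|right; exists (inl j)].
have edgeA s a t' : sum_src (A := A) (B := B) s = inl a ->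
    (sum_edge s t' <-> exists2 t, edge a t & t' = hA t).
  rewrite /sum_edge => ->; split=> [|[t e ->]]; last by rewrite tgtA.
  by have [[t ->]|[t ->]] := tgtP t'; rewrite ?tgtA ?tgtB// => e; exists t.
have edgeB s a t' : sum_src (A := A) (B := B) s = inr a ->
    (sum_edge s t' <-> exists2 t, edge a t & t' = hB t).
  rewrite /sum_edge => ->; split=> [|[t e ->]]; last by rewrite tgtB.
  by have [[t ->]|[t ->]] := tgtP t'; rewrite ?tgtA ?tgtB// => e; exists t.
apply: (@W_juxtaposition R m n k l (m + k) (n + l) A B _ hA hB SA SB
  (fun i => match fintype.split i with inl a => hA (SA a) | inr b => hB (SB b) end)
  (@sumSP R m n k l)) => //.
- by move=> q t'; apply: edgeA.
- by move=> q t'; apply: edgeB.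
- move=> i t'; case E : (fintype.split i) => [a|b].
  + rewrite (@edgeA _ (inl a)) /= ?E//.
    by split=> [[t /SAP -> //]|->]; exists (SA a) => //; exact/SAP.
  + rewrite (@edgeB _ (inl b)) /= ?E//.
    by split=> [[t /SBP -> //]|->]; exists (SB b) => //; exact/SBP.
- move=> nA nB nC outA outB i; rewrite /sumSP; case: (fintype.split i) => a.
  + by rewrite omap_out_bnd outA; congr obnd; apply/funext => j; rewrite outf_exit.
  + by rewrite omap_out_bnd outB; congr obnd; apply/funext => j; rewrite outf_exit.
Qed.

(** * Trace *)

Section Enumeration.
Variable P : pred nat.

Lemma increasing_enum : (forall j, exists2 i, (j <= i)%N & P i) ->
  exists phi : nat -> nat, {homo phi : a b / (a < b)%N} /\
    (forall j, P j <-> exists t, phi t = j).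
Proof.
move=> infP.
have /choice[nx Hnx] : forall j, exists i, [/\ (j <= i)%N, P i &
    forall i', (j <= i')%N -> P i' -> (i <= i')%N].
  move=> j; have ex : exists i, ((j <= i) && P i)%N by have [i ? ?] := infP j; exists i; apply/andP.
  case: (ex_minnP ex) => i /andP[ji Pi] min; exists i; split=> // i' ji' Pi'.
  by apply: min; rewrite ji'.
pose phi := fix phi k := if k is k'.+1 then nx (phi k').+1 else nx 0%N.
have phiS k : (phi k < phi k.+1)%N by have [] := Hnx (phi k).+1.
have phi_lt : {homo phi : a b / (a < b)%N} by apply: homo_ltn phiS; exact: ltn_trans.
exists phi; split=> // j; split=> [Pj|[[|t] <-]]; last 2 first.
- by have [] := Hnx 0%N.
- by have [] := Hnx (phi t).+1.
have ex : exists T, (j <= phi T)%N.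
  exists j; elim: {Pj} j => // j IH; exact: leq_ltn_trans IH (phiS j).
case: (ex_minnP ex) => T jT min; exists T; apply/eqP; rewrite eqn_leq jT andbT.
case: T jT min => [_ _|T _ min]; first by have [_ _] := Hnx 0%N; apply.
have [_ _] := Hnx (phi T).+1; apply=> //; rewrite ltnNge; apply/negP => /min.
by rewrite ltnn.
Qed.

(** This makes infinite traces single-valued. If [f] and [g] agree below [k], then [g] takes the
    value [f k] at an index that is at least [k], so [g k <= f k]; the roles are symmetric. *)
Lemma increasing_enum_unique (phi psi : nat -> nat) :
  {homo phi : a b / (a < b)%N} -> {homo psi : a b / (a < b)%N} ->
  (forall j, P j <-> exists t, phi t = j) -> (forall j, P j <-> exists t, psi t = j) ->
  phi = psi.
Proof.
have le (f g : nat -> nat) k : {homo f : a b / (a < b)%N} -> {homo g : a b / (a < b)%N} ->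
    (forall j, P j <-> exists t, f t = j) -> (forall j, P j <-> exists t, g t = j) ->
    (forall i, (i < k)%N -> f i = g i) -> (g k <= f k)%N.
  move=> fi gi fP gP eq; have /gP[t tk] : P (f k) by apply/fP; exists k.
  have [kt|] := leqP k t; first by rewrite -tk leq_mono.
  by move=> tk'; have := fi _ _ tk'; rewrite eq// tk ltnn.
move=> fi gi fP gP; apply/funext => k; elim/ltn_ind: k => k IH.
apply/eqP; rewrite eqn_leq; apply/andP; split; apply: le => // i ik.
by rewrite IH.
Qed.

(** For quantities accumulated along a trace sequence, such as partial sums, which change only at
    weighted entries: nothing happens between two consecutive values of [phi]. *)
Lemma enum_const (T : Type) (F : nat -> T) (phi : nat -> nat) :
  {homo phi : a b / (a < b)%N} -> (forall j, P j <-> exists t, phi t = j) ->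
  (forall j, ~~ P j -> F j.+1 = F j) ->
  F (phi 0%N) = F 0%N /\ (forall k, F (phi k.+1) = F (phi k).+1).
Proof.
move=> phi_lt phiP Fconst.
have const a b : (a <= b)%N -> (forall j, (a <= j < b)%N -> ~~ P j) -> F b = F a.
  move=> ab; rewrite -(subnKC ab); elim: (b - a)%N => [|d IH] N; first by rewrite addn0.
  rewrite addnS Fconst; last by apply: N; rewrite addnS leq_addr ltnSn.
  by apply: IH => j jd; apply: N; move: jd; rewrite addnS; lia.
have phi_le : {mono phi : a b / (a < b)%N}.
  exact: leqW_mono (leq_mono phi_lt).
split=> [|k]; apply: const => //.
- move=> j /andP[_]; apply: contraTN => /phiP[t <-].
  by rewrite phi_le ltn0.
- exact: phi_lt.
- move=> j jk; apply/negP => /phiP[t tj]; move: jk; rewrite -tj.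
  by rewrite !phi_le; lia.
Qed.

End Enumeration.

(** * Results of trace sequences *)

Section TraceOutcome.
Variables (R : realType) (l m n : nat) (f : SParrow R (l + m) (l + n)).
Implicit Types o : outc R (l + n).

Definition tr_next o : option (outc R (l + n)) :=
  match o with
  | Exit k | WExit _ k =>
      if fintype.split k is inl a then Some (f (lshift m a)) else None
  | _ => None
  end.

(* [tr_seq f i] is [tr_from (f (rshift l i))]; an arbitrary first value is needed to reason by
   induction along the sequence. *)
Fixpoint tr_from o (j : nat) : option (outc R (l + n)) :=
  if j is j'.+1 then obind tr_next (tr_from o j') else Some o.

Lemma tr_seq_from i j : tr_seq f i j = tr_from (f (rshift l i)) j.
Proof. by elim: j => //= j ->; case: (tr_from _ j) => // -[]. Qed.

Lemma tr_from_next o o' j : tr_next o = Some o' -> tr_from o j.+1 = tr_from o' j.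
Proof. by move=> oo'; elim: j => // j IH; rewrite -[LHS]/(obind _ (tr_from o j.+1)) IH. Qed.

Lemma tr_from_stop o j j' : (j <= j')%N -> tr_from o j = None -> tr_from o j' = None.
Proof. by move=> /subnK <-; elim: (j' - j)%N => //= d IH /IH ->. Qed.

(** [tr_fin] and [tr_inf] are the disjuncts of [trSP_at] for an arbitrary sequence, so that they
    apply to [tr_from]. *)
Definition tr_fin (v : nat -> option (outc R (l + n))) (o : outc R n) : Prop :=
  exists K (x : outc R (l + n)), v K = Some x /\ v K.+1 = None /\
     let S := \sum_(j < K.+1) wfst (v j) in
     match x with
     | EWin => o = EWin R n
     | AWin => o = AWin R n
     | Exit k' =>
         match fintype.split k' with
         | inl _ => False
         | inr k => if [exists j : 'I_K, weighted (v j)]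
                    then o = WExit S k else o = Exit R k
         end
     | WExit _ k' =>
         match fintype.split k' with inl _ => False | inr k => o = WExit S k end
     end.

Definition tr_inf (v : nat -> option (outc R (l + n))) (o : outc R n) : Prop :=
  (forall j, v j <> None) /\
   exists phi : nat -> nat, {homo phi : a b / (a < b)%N} /\
     (forall j, weighted (v j) <-> exists t, phi t = j) /\
     let w' := fun t => wfst (v (phi t)) in
     ((mp_ok w' /\ o = EWin R n) \/ (~ mp_ok w' /\ o = AWin R n)).

Lemma trSP_atE i (x : outc R n) : trSP_at f i x <->
  tr_fin (tr_from (f (rshift l i))) x \/ tr_inf (tr_from (f (rshift l i))) x.
Proof.
have <- : tr_seq f i = tr_from (f (rshift l i)) by apply/funext => j; exact: tr_seq_from.
by [].
Qed.

Lemma tr_unique o (o1 o2 : outc R n) : tr_fin (tr_from o) o1 \/ tr_inf (tr_from o) o1 ->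
  tr_fin (tr_from o) o2 \/ tr_inf (tr_from o) o2 -> o1 = o2.
Proof.
move=> [[K1 [x1 [v1 [e1 h1]]]]|[i1 [phi [phi_lt [phiP h1]]]]]
  [[K2 [x2 [v2 [e2 h2]]]]|[i2 [psi [psi_lt [psiP h2]]]]].
- have eK : K1 = K2.
    apply/eqP; rewrite eqn_leq; apply/andP; split; rewrite leqNgt; apply/negP => lt.
    + by rewrite (tr_from_stop lt e2) in v1.
    + by rewrite (tr_from_stop lt e1) in v2.
  subst K2; rewrite v1 in v2; case: v2 => ?; subst x2.
  case: x1 {v1} h1 h2 => [k|r k| -> -> | -> ->] //=; case: (fintype.split k) => // k'.
  + by case: [exists _, _] => -> ->.
  + by move=> -> ->.
- by have := i2 K1.+1.
- by have := i1 K2.+1.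
- move: h1 h2; rewrite (increasing_enum_unique phi_lt psi_lt phiP psiP) /=.
  by move=> [[? ->]|[? ->]] [[? ->]|[? ->]].
Qed.

Lemma weightedPn (v : option (outc R (l + n))) : ~~ weighted v -> wfst v = 0.
Proof. by case: v => // -[]. Qed.

(** The counterpart of [outf_step] for trace sequences: a new first value contributes its weight if
    it carries one. *)
Lemma tr_fin_step o o' (x : outc R n) : tr_next o = Some o' -> tr_fin (tr_from o') x ->
  tr_fin (tr_from o) (if o is WExit r _ then wadd r x else x).
Proof.
move=> oo' [K [y [yK [yN hy]]]]; have vS j := tr_from_next j oo'.
exists K.+1, y; rewrite !vS; do 2 split => //.
have exS : [exists j : 'I_K.+1, weighted (tr_from o j)] =
    weighted (Some o) || [exists j : 'I_K, weighted (tr_from o' j)].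
  apply/existsP/orP => [[[[|j] jK] /= wj]|[wo|/existsP[j wj]]].
  - by left.
  - by right; apply/existsP; exists (Ordinal (jK : (j < K)%N)); rewrite -vS.
  - by exists ord0.
  - by exists (lift ord0 j); rewrite vS.
have sumS : \sum_(j < K.+2) wfst (tr_from o j) =
    wfst (Some o) + \sum_(j < K.+1) wfst (tr_from o' j).
  by rewrite big_ord_recl; congr (_ + _); apply: eq_bigr => j _; rewrite vS.
rewrite exS sumS /=; case: y yK hy => [k|r k| | ] yK /=.
- case: (fintype.split k) => // k'.
  have [ex|noex] := boolP [exists j : 'I_K, weighted (tr_from o' j)] => ->.
  + rewrite orbT; case: o oo' {vS exS sumS} => //= ? _.
    by rewrite add0r.
  (* No entry before [K] is weighted and entry [K] is a plain exit, so only the weight of [o] can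
     remain. *)
  + have -> : \sum_(j < K.+1) wfst (tr_from o' j) = 0.
      rewrite big1// => j _; apply: weightedPn.
      move: (ltn_ord j); rewrite ltnS leq_eqVlt => /orP[/eqP ->|jK]; first by rewrite yK.
      by move: noex; rewrite negb_exists => /forallP/(_ (Ordinal jK)).
    by rewrite orbF addr0; case: o oo' {vS exS sumS}.
- case: (fintype.split k) => // k' ->; case: o oo' {vS exS sumS} => //= ? _.
  by rewrite add0r.
- by move=> ->; case: o oo' {vS exS sumS}.
- by move=> ->; case: o oo' {vS exS sumS}.
Qed.

End TraceOutcome.

(** * Feedback loops and the outcome of the traced game *)

Section Resolution.
Variables (R : realType) (l m n : nat) (E : roMPG R (l + m) (l + n)).
Variable S : 'I_(l + m) -> vtx E.
Hypothesis SP : forall i t, edge (inl i) t <-> t = S i.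

(* [resolves t t']: following the feedback loops from the target [t] of an edge of [E] leads to
   [t'], the target of an edge of [trG E]. *)
Inductive resolves : vtx E -> vtx (trG E) -> Prop :=
| resolves_pos q : resolves (inr q) (inr q)
| resolves_exit k : resolves (inl (rshift l k)) (inl k)
| resolves_loop j t' : resolves (S (lshift m j)) t' -> resolves (inl (lshift n j)) t'.

Lemma resolves_posE q t' : resolves (inr q) t' -> t' = inr q.
Proof. by move=> H; inversion H. Qed.

(** Inversion stated by [fintype.split], so that the index of an exit need not have the form
    [lshift] or [rshift]. *)
Lemma resolvesE t t' : resolves t t' ->
  match t with
  | inr q => t' = inr q
  | inl k => match fintype.split k with
             | inl j => resolves (S (lshift m j)) t'
             | inr k' => t' = inl k'
             end
  end.
Proof.
case=> // [k|j u H].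
- by rewrite (unsplitK (inr k)).
- by rewrite (unsplitK (inl j)).
Qed.

(** An entrance has a single successor, so after the first edge a chain is forced and its list of
    loops can be forgotten. *)
Lemma chain_resolves a s' :
  (exists p, chain a p (hat_tgt s')) <-> exists2 t, edge a t & resolves t s'.
Proof.
split=> [[p]|[t at_ ts]].
- elim: p a => [|j p IH] a /=.
    move=> e; exists (hat_tgt s') => //.
    by case: s' {e} => [k|q]; [exact: resolves_exit|exact: resolves_pos].
  move=> [aj /IH[t /SP -> ts]]; exists (inl (lshift n j)) => //.
  exact: resolves_loop.
- elim: ts a at_ => {t s'} [q|k|j t' _ IH] a at_; [by exists [::]|by exists [::]|].
  by have [p ch] := IH _ ((SP _ _).2 erefl); exists (j :: p).
Qed.

Lemma tr_edgeE s s' : edge (r := trG E) s s' <->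
  exists2 t, edge (r := E) (hat_src s) t & resolves t s'.
Proof. exact: chain_resolves. Qed.

(* Exits have at most one predecessor, so a chain of loops entered from outside never revisits one
   of the exits, collected in [V], which it has passed. *)
Lemma resolves_total a t : wf E -> (forall j, a <> inl (lshift m j)) -> edge a t ->
  exists t', resolves t t'.
Proof.
move=> [_ pred_uniq] a_out at_.
(* Induction on the number of exits not passed yet; the invariant says where the passed exits and
   [j] were entered from. *)
suff loop N (V : {set 'I_l}) j : (#|~: V| <= N)%N -> j \notin V ->
    (forall v, v \in j |: V -> exists2 b, edge b (inl (lshift n v)) &
       b = a \/ exists2 v', v' \in V & b = inl (lshift m v')) ->
    exists t', resolves (inl (lshift n j)) t'.
  case: t at_ => [k|q] at_; last by exists (inr q); exact: resolves_pos.
  case: (split_ordP k) at_ => [j ->|k' ->] at_; last by exists (inl k'); exact: resolves_exit.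
  apply: (loop _ finset.set0 j (leqnn _)); first by rewrite finset.in_set0.
  by move=> v; rewrite finset.setU0 => /finset.set1P ->; exists a => //; left.
elim: N V j => [|N IH] V j cardV jV preds.
  by move: cardV; rewrite leqn0 cards_eq0 => /eqP/setP/(_ j); rewrite !inE jV.
case Sj : (S (lshift m j)) => [k|q]; last first.
  by exists (inr q); apply: resolves_loop; rewrite Sj; exact: resolves_pos.
case: (split_ordP k) Sj => [j' -> |k' ->] Sj; last first.
  by exists (inl k'); apply: resolves_loop; rewrite Sj; exact: resolves_exit.
have ej : edge (r := E) (inl (lshift m j)) (inl (lshift n j')) by apply/SP.
(* If [j'] had been passed, its only predecessor, entrance [j], would be [a] or belong to [V]. *)
have j'V : j' \notin j |: V.
  apply/negP => /preds[b bj'].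
  have -> : b = inl (lshift m j) by exact: pred_uniq bj' ej.
  by case=> [ja|[v' v'V [/val_inj jv']]]; [exact: a_out (esym ja)|by rewrite jv' v'V in jV].
have cardV' : (#|~: (j |: V)| <= N)%N.
  rewrite -ltnS; apply: leq_trans cardV; apply: proper_card.
  apply/properP; split; first by rewrite finset.setCS finset.subsetUr.
  by exists j; rewrite !inE ?jV// eqxx.
have [|t' jt'] := IH (j |: V) j' cardV' j'V; last first.
  by exists t'; apply: resolves_loop; rewrite Sj.
move=> v; rewrite in_setU1 => /orP[/eqP ->|vjV].
  by exists (inl (lshift m j)) => //; right; exists j => //; exact: finset.setU11.
have [b bv bP] := preds _ vjV; exists b => //.
case: bP => [->|[v' v'V ->]]; [by left|right; exists v' => //].
by rewrite in_setU1 v'V orbT.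
Qed.

Section Outcome.
Variables (nE : pos E -> option (vtx E)) (nT : pos (trG E) -> option (vtx (trG E))).
Hypothesis nP : forall q, orel resolves (nE q) (nT q).
Let f : SParrow R (l + m) (l + n) := fun i => outf nE (S i).

Let sim t t' : resolves t t' -> _ :=
  @outf_sim R _ _ _ _ E (trG E) nE nT id resolves (fun=> erefl) (fun=> erefl) resolves_posE nP t t'.

(** Induction on the stopping time: at a loop exit, [outf_sim] continues the play and [tr_fin_step]
    the sequence, both adding the same weight. *)
Lemma tr_fin_outf t t' K : resolves t t' -> tr_from f (outf nE t) K = None ->
  tr_fin (tr_from f (outf nE t)) (outf nT t').
Proof.
elim: K t t' => // K IH t t' tt' stop; have := sim tt'.
have exitE k u : resolves (inl k) u ->
    match fintype.split k with
    | inl j => resolves (S (lshift m j)) u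
    | inr k' => outf nT u = Exit R k'
    end.
  by move=> /resolvesE; case: (fintype.split k) => // k' ->; rewrite outf_exit.
case out : (outf nE t) => [k|r k| | ].
- move=> [u /exitE ku ->].
  case sk : (fintype.split k) ku => [j|k'] ku.
  + have next : tr_next f (outf nE t) = Some (f (lshift m j)) by rewrite out /= sk.
    have := tr_fin_step next; rewrite out; apply.
    by apply: IH ku _; rewrite -(tr_from_next K next).
  + exists 0%N, (Exit R k); do !split; rewrite /= ?sk//.
    by case: existsP => [[[]]|].
- move=> [u /exitE ku ->].
  case sk : (fintype.split k) ku => [j|k'] ku.
  + have next : tr_next f (outf nE t) = Some (f (lshift m j)) by rewrite out /= sk.
    have := tr_fin_step next; rewrite out; apply.
    by apply: IH ku _; rewrite -(tr_from_next K next).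
  + exists 0%N, (WExit r k); do !split; rewrite /= ?sk//.
    by rewrite ku big_ord1.
- by move=> ->; exists 0%N, (EWin R _).
- by move=> ->; exists 0%N, (AWin R _).
Qed.

(* Each weighted value of the trace sequence is the weight of a block of consecutive positions of
   the play in [trG E]; blocks have bounded length, so both mean-payoff conditions agree. *)
Lemma tr_inf_outf t t' : resolves t t' -> (forall j, tr_from f (outf nE t) j <> None) ->
  tr_inf (tr_from f (outf nE t)) (outf nT t').
Proof.
move=> tt' inf; split=> //.
(* [u j] is the target in [E] whose outcome is entry [j] of the sequence; the default [t] is never
   taken, as the sequence is infinite. *)
pose u := fix u j := if j is j'.+1 then
    match outf nE (u j') with
    | Exit k | WExit _ k => if fintype.split k is inl a then S (lshift m a) else t
    | _ => t
    end else t.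
have tr_u j : tr_from f (outf nE t) j = Some (outf nE (u j)).
  elim: j => // j IH; have := inf j.+1; rewrite /= IH /=.
  by case: (outf nE (u j)) => //= [k|r k]; case: (fintype.split k).
have /choice[c cP] := exit_time nE.
(* Block [j] runs from [u j] to a loop exit [a]; it is empty iff entry [j] is unweighted. *)
have block j : exists a, [/\ u j.+1 = S (lshift m a),
    run nE (u j) (c (u j)) = Some (inl (lshift n a)),
    wfst (Some (outf nE (u j))) = \sum_(i < c (u j)) wt_of (run nE (u j) i) &
    weighted (Some (outf nE (u j))) = (0 < c (u j))%N].
  have := inf j.+1; rewrite /= tr_u /=.
  case out : (outf nE (u j)) => [k|r k| | ] //=; case: (split_ordP k) => // a ka _; exists a.
  - have [/(_ out)[c0 uj] _] := cP (u j) k.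
    by rewrite c0 big_ord0 uj ka.
  - by have [_ /(_ _ out)[c0 runc ->]] := cP (u j) k; rewrite runc ka.
(* [p j] is the time in the play of [trG E] at which the first [j] blocks are complete. *)
pose p j := (\sum_(i < j) c (u i))%N.
have pS j : p j.+1 = (p j + c (u j))%N by rewrite /p big_ord_recr.
have at_p j : exists2 t'', run nT t' (p j) = Some t'' & resolves (u j) t''.
  elim: j => [|j [t'' runp ut'']]; first by exists t' => //; rewrite /p big_ord0.
  have [a [-> runc _ _]] := block j.
  have [v runv] := run_sim (A := E) (C := trG E) (e := id) resolves_posE nP ut'' runc.
  move=> /resolvesE; rewrite (unsplitK (inl a)) => av.
  by exists v => //; rewrite pS (runD _ runp).
have sum_p j : \sum_(i < j) wfst (tr_from f (outf nE t) i) =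
    \sum_(i < p j) wt_of (run nT t' i).
  elim: j => [|j IH]; first by rewrite /p !big_ord0.
  rewrite big_ord_recr IH pS big_split_ord /=; congr (_ + _).
  have [a [_ runc wfstE _]] := block j; rewrite tr_u wfstE.
  have [t'' runp ut''] := at_p j; apply: eq_bigr => i _.
  rewrite (runD _ runp).
  apply/esym/(wt_sim (A := E) (C := trG E) (e := id) (fun=> erefl) resolves_posE nP ut'').
  by move=> /(run_mono (ltn_ord i)); rewrite runc.
have weightedE j : weighted (tr_from f (outf nE t) j) = (0 < c (u j))%N.
  by rewrite tr_u; have [a []] := block j.
(* Empty blocks just follow loops, so induction on the resolution of [u j] reaches a nonempty
   one. *)
have often j : exists2 i, (j <= i)%N & weighted (tr_from f (outf nE t) i).
  have [t'' _ ut''] := at_p j; move uE : (u j) ut'' => x ut''.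
  elim: ut'' j uE => {x t''} [q|k|i v _ IH] j uE; have [a [uS runc _ _]] := block j.
  - by exists j; rewrite ?weightedE//; move: runc; rewrite uE; case: (c _).
  - move: runc; rewrite uE; case: (c _) => [[]|x]; last by rewrite run_exit.
    by move=> ka; have := ltn_ord a; rewrite -ka /=; lia.
  - have [c0|c0] := posnP (c (u j)); last by exists j; rewrite ?weightedE.
    move: runc; rewrite c0 uE => -[/val_inj ia].
    have uj : u j.+1 = S (lshift m i) by rewrite uS ia.
    by have [i' ji' wi'] := IH j.+1 uj; exists i' => //; exact: ltnW.
have infT k : run nT t' k <> None.
  have [j kj] : exists j, (k <= p j)%N.
    elim: k => [|k [j kj]]; first by exists 0%N.
    have [i ji wi] := often j; exists i.+1; rewrite pS.
    have : (p j <= p i)%N.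
      by rewrite -(subnKC ji) /p big_split_ord leq_addr.
    by move: wi; rewrite weightedE; lia.
  by move=> /(run_mono kj); have [? ->] := at_p j.
have [phi [phi_lt phiP]] := increasing_enum often.
exists phi; do 2 split => //.
have [p0 pphi] : p (phi 0%N) = p 0%N /\ forall k, p (phi k.+1) = p (phi k).+1.
  apply: (enum_const phi_lt phiP) => j; rewrite weightedE pS.
  by case: (c (u j)) => // _; rewrite addn0.
pose F j := \sum_(i < j) wfst (tr_from f (outf nE t) i).
have [F0 Fphi] : F (phi 0%N) = F 0%N /\ forall k, F (phi k.+1) = F (phi k).+1.
  apply: (enum_const phi_lt phiP) => j /weightedPn w0.
  by rewrite /F big_ord_recr /= w0 addr0.
have mpE : mp_ok (fun k => wfst (tr_from f (outf nE t) (phi k))) <->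
    mp_ok (fun i => wt_of (run nT t' i)).
  (* Only nonempty blocks are listed. Their lengths are bounded as there are finitely many targets,
     and each weight by the sum of all absolute weights. *)
  apply: (@mp_blocks _ _ _ (p \o phi) (\max_(x : 'I_(l + n) + pos E) c x)
    (\sum_q `|wt (r := E) q|)) => /=.
  - move=> k; case: (run nT t' k) => [[?|q]|] /=; rewrite ?normr0 ?sumr_ge0//.
    by rewrite (bigD1 q)//= lerDl sumr_ge0.
  - by rewrite p0 /p big_ord0.
  - move=> k; rewrite pphi pS.
    have : weighted (tr_from f (outf nE t) (phi k)) by apply/phiP; exists k.
    rewrite weightedE => c0; apply/andP; split; first by lia.
    by rewrite leq_add2l; exact: (leq_bigmax (u (phi k))).
  - move=> k; rewrite -sum_p -/(F _).
    elim: k => [|k IH]; first by rewrite F0 /F !big_ord0.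
    by rewrite big_ord_recr IH Fphi /F big_ord_recr.
rewrite (outf_inf infT); case: pselect => mp; [left|right]; split=> //; first exact/mpE.
by move=> /mpE.
Qed.

Lemma trace_outf t t' : resolves t t' ->
  tr_fin (tr_from f (outf nE t)) (outf nT t') \/ tr_inf (tr_from f (outf nE t)) (outf nT t').
Proof.
move=> tt'; have [inf|] := pselect (forall j, tr_from f (outf nE t) j <> None).
  by right; exact: tr_inf_outf.
by move=> /existsNP[K] /contrapT stop; left; exact: (tr_fin_outf tt' stop).
Qed.

End Outcome.
End Resolution.

(** Strategies are matched along [resolves]. [trace_outf] shows that the outcomes in [trG E] form a
    trace, and [tr_unique] that they are the only one. *)
Lemma W_trG (R : realType) l m n (E : roMPG R (l + m) (l + n)) :
  wf E -> wf (trG E) -> W (trG E) = trS (W E).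
Proof.
move=> wfE /wf_entry[T TP]; have [S SP] := wf_entry wfE.
have edgeP q t' := tr_edgeE SP (inr q) t'.
have total q t : edge (r := E) (inr q) t -> exists t', resolves S t t'.
  by apply: resolves_total wfE _.
have ent i : resolves S (S (rshift l i)) (T i).
  have /(tr_edgeE SP)[t /SP ->] : edge (r := trG E) (inl i) (T i) by apply/TP.
  by [].
pose M (tE : pos E -> option (vtx E)) (tT : pos (trG E) -> option (vtx (trG E))) :=
  forall q, orel (resolves S) (tE q) (tT q).
apply: (W_image1 (M := M)).
- move=> r tE sE.
  have /choice[tT HT] : forall q : pos (trG E), exists o', move_ok r q o' /\
      orel (resolves S) (tE q) o'.
    move=> q; have [o' ? ?] :=
      @move_ok_push _ _ _ _ _ E (trG E) q q _ erefl
        (edgeP q) (@total q) r _ (sE q).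
    by exists o'.
  by exists tT => q; have [] := HT q.
- move=> r tT sT.
  have /choice[tE HE] : forall q : pos E, exists o, move_ok r q o /\
      orel (resolves S) o (tT q).
    move=> q; have [o ? ?] :=
      @move_ok_pull _ _ _ _ _ E (trG E) q q _ erefl
        (edgeP q) (@total q) r _ (sT q).
    by exists o.
  by exists tE => q; have [] := HE q.
- move=> tEE tFE tET tFT _ _ _ _ ME MF h.
  have nP q : orel (resolves S) (nxt tEE tFE q) (nxt tET tFT q).
    by apply: (orel_nxt (A := E) (C := trG E)).
  have trace i : trSP_at (fun i => outf (nxt tEE tFE) (S i)) i (outf (nxt tET tFT) (T i)).
    apply/trSP_atE; exact: trace_outf.
  have playsT := plays_entry (A := trG E) tET tFT h TP.
  have playsE f := plays_entry tEE tFE f SP.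
  split=> [/playsT ->|[f /playsE -> trh]].
  + by exists (fun i => outf (nxt tEE tFE) (S i)) => //; apply/playsE.
  + apply/playsT/funext => i.
    exact: tr_unique ((trSP_atE _ _ _).1 (trh i)) ((trSP_atE _ _ _).1 (trace i)).
Qed.

Theorem theorem4p11 (R : realType) :
  (* W_r lands in S_r *)
  (forall m n (A : roMPG R m n), wf A -> isSr (W A)) /\
  (* W_r is well defined on isomorphism classes *)
  (forall m n (A B : roMPG R m n), iso A B -> W A = W B) /\
  (* identities and symmetries *)
  (forall m, W (idG R m) = @idS R m) /\
  (forall m n, W (symG R m n) = @symS R m n) /\
  (* composition *)
  (forall m l n (A : roMPG R m l) (B : roMPG R l n),
     wf A -> wf B -> W (compG A B) = compS (W A) (W B)) /\
  (* monoidal product *)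
  (forall m n k l (A : roMPG R m n) (B : roMPG R k l),
     wf A -> wf B -> W (sumG A B) = sumS (W A) (W B)) /\
  (* trace *)
  (forall l m n (E : roMPG R (l + m) (l + n)),
     wf E -> wf (trG E) -> W (trG E) = trS (W E)).
Proof.
split; first by move=> m n A; exact: W_isSr.
split; first by move=> m n A B; exact: W_iso.
split; first exact: W_idG.
split; first exact: W_symG.
split; first by move=> m l n A B; exact: W_compG.
split; first by move=> m n k l A B; exact: W_sumG.
exact: W_trG.
Qed.
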